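(* Let $G$ be a proper circular-arc graph, with $\varrho(G)$ computed with respect to a proper arc representation, and let $\delta(G)$ be its hyperbolicity constant. If $\varrho(G)\ge 3$, then $$\frac14\,\varrho(G)\le\delta(G)\le \frac12\Big\lfloor\frac12\,\varrho(G)\Big\rfloor+1,$$ and these inequalities are sharp. If $\varrho(G)=1$, then $\delta(G)=0$. If $\varrho(G)=2$, then $0\le\delta(G)\le 5/4$, and these inequalities are sharp.
   Context: Graphs are simple, possibly infinite, with every edge of length $1$, regarded as metric spaces by identifying each edge isometrically with $[0,1]$, with the shortest-path distance. A geodesic triangle is a union of three geodesics joining three points; it is $\delta$-thin if each side lies in the $\delta$-neighborhood of the union of the other two. $\delta(G)$ is the supremum over geodesic triangles $T$ of the infimum of $\delta$ with $T$ $\delta$-thin (for disconnected graphs, the supremum over components). A circular-arc graph is given by arcs $\{I_v\}_{v\in V(G)}$ of the unit circle $\mathbb{S}^1$, with distinct $u,v$ adjacent iff $I_u\cap I_v\ne\emptyset$. It is proper if it has such a representation in which no arc contains another. A finite set $K$ of vertices is total if $\bigcup_{v\in K}I_v=\mathbb{S}^1$, of size $|K|$; $\varrho(G)$ is the minimum size of a total set, and $\varrho(G)=0$ if there is none. *)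

(* Defs.v *)
From HB Require Import structures.
From mathcomp Require Import all_boot all_order all_algebra.
From mathcomp Require Import all_classical all_reals all_analysis.

Set Implicit Arguments.
Unset Strict Implicit.
Unset Printing Implicit Defensive.

Import Order.TTheory GRing.Theory Num.Theory.

Local Open Scope classical_set_scope.
Local Open Scope ring_scope.

Record graph (V : Type) := Graph {
  adj : V -> V -> Prop;
  adj_sym : forall u v, adj u v -> adj v u;
  adj_irrefl : forall v, ~ adj v v }.

Section MetricGraph.
Variables (R : realType) (V : Type) (G : graph V).

(* A point of the geometric realization is given by its barycentric
   coordinates, a function V -> R: the vertex v is the indicator function of
   [set v], and the point at distance t from u on the edge uv is
   (1 - t) u + t v. *)
Definition vertex_point (v : V) : V -> R := \1_[set v].

Definition edge_point (u v : V) (t : R) : V -> R :=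
  fun w => (1 - t) * vertex_point u w + t * vertex_point v w.

Definition closed_edge (u v : V) : set (V -> R) :=
  [set edge_point u v t | t in `[0, 1]%classic].

Definition realization : set (V -> R) :=
  [set x | (exists v, x = vertex_point v) \/
           (exists u v, adj G u v /\ closed_edge u v x)].

(* chain x y l: x and y are joined by a finite concatenation of segments,
   each contained in one closed edge, of total length l.  For x in the closed
   edge uv, the number x v is the coordinate of x in the identification of
   this edge with [0, 1] that sends u to 0 and v to 1. *)
Inductive chain : (V -> R) -> (V -> R) -> R -> Prop :=
| chain_nil x : chain x x 0
| chain_cons x y z u v l :
    adj G u v -> closed_edge u v x -> closed_edge u v y -> chain y z l ->
    chain x z (`|x v - y v| + l).

(* Equal to +oo between different connected components. *)
Definition dist (x y : V -> R) : \bar R :=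
  ereal_inf [set l%:E | l in chain x y].

(* A geodesic is parametrized by arc length on [0, L]. *)
Definition geodesic (x y : V -> R) (L : R) (g : R -> V -> R) : Prop :=
  [/\ 0 <= L, g 0 = x, g L = y,
      forall s, s \in `[0, L] -> realization (g s) &
      forall s t, s \in `[0, L] -> t \in `[0, L] ->
        dist (g s) (g t) = `|s - t|%:E].

Definition geodesic_side (x y : V -> R) (S : set (V -> R)) : Prop :=
  exists L g, geodesic x y L g /\ S = g @` `[0, L]%classic.

Definition geodesic_triangle (S1 S2 S3 : set (V -> R)) : Prop :=
  exists x y z, [/\ geodesic_side x y S1, geodesic_side y z S2 &
                    geodesic_side z x S3].

Definition neighborhood (d : R) (A : set (V -> R)) : set (V -> R) :=
  [set p | exists2 q, A q & (dist p q <= d%:E)%E].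

Definition thin (d : R) (S1 S2 S3 : set (V -> R)) : Prop :=
  [/\ S1 `<=` neighborhood d (S2 `|` S3),
      S2 `<=` neighborhood d (S3 `|` S1) &
      S3 `<=` neighborhood d (S1 `|` S2)].

Definition triangle_delta (S1 S2 S3 : set (V -> R)) : \bar R :=
  ereal_inf [set d%:E | d in [set d : R | thin d S1 S2 S3]].

(* Points in different components are at distance +oo, so every geodesic
   triangle lies in one component: for a disconnected graph this is the
   supremum of the hyperbolicity constants of the components. *)
Definition delta : \bar R :=
  ereal_sup [set e | exists S1 S2 S3,
    geodesic_triangle S1 S2 S3 /\ e = triangle_delta S1 S2 S3].

End MetricGraph.

Arguments delta R {V} G.

Section CircularArcs.
Variable R : realType.

Definition circle : set (R * R) := [set p | p.1 ^+ 2 + p.2 ^+ 2 = 1].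

(* The closed arc swept by the angles in [a, b]; it is the whole circle when
   b - a >= 2 pi. *)
Definition closed_arc (a b : R) : set (R * R) :=
  [set (cos t, sin t) | t in `[a, b]%classic].

Definition is_arc (A : set (R * R)) : Prop :=
  exists a b : R, a < b /\ A = closed_arc a b.

Variable V : Type.

Definition arc_representation (G : graph V) (I : V -> set (R * R)) : Prop :=
  (forall v, is_arc (I v)) /\
  (forall u v, adj G u v <-> u <> v /\ I u `&` I v !=set0).

(* Two distinct vertices with the same arc are excluded as well. *)
Definition proper_arc_representation (G : graph V) (I : V -> set (R * R)) :
    Prop :=
  arc_representation G I /\ (forall u v, u <> v -> ~ (I u `<=` I v)).

Definition is_total (I : V -> set (R * R)) (K : set V) : Prop :=
  \bigcup_(v in K) I v = circle.

Definition total_size (I : V -> set (R * R)) : set nat :=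
  [set n | exists K : set V, (K #= `I_n)%card /\ is_total I K].

(* The default value 0 of xget is taken when there is no finite total set. *)
Definition rho (I : V -> set (R * R)) : nat :=
  xget 0%N [set n | total_size I n /\
                    forall m, total_size I m -> (n <= m)%N].

End CircularArcs.

(* Main.v *)
(* Lift the arcs to the line R, the universal cover of the circle.  Properness
   says that left ends and right ends of the lifts are ordered alike, so the n
   arcs of a minimum total set, sorted by left end, form a cycle C_n of G, and a
   closed walk of lifts that winds around the circle visits a total set, hence
   has length at least n.  Therefore C_n is isometric, and two antipodal points
   of C_n span a bigon whose sides have their midpoints n/4 apart from the other
   side.  Every vertex meets two consecutive arcs of the cycle, so the vertices
   have diameter at most floor(n/2) + 1, and delta is at most half of the
   diameter of the whole graph.

   When n = 2 some vertex is adjacent to all others; as an arc meeting another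
   one without being contained in it contains one of its two ends, no three
   vertices are independent.  A point at distance more than 5/4 from the two
   other sides of a triangle would be near a vertex m whose neighbourhood these
   sides avoid, and they would contain two more vertices independent with m. *)

Require Import Defs.
From HB Require Import structures.
From mathcomp Require Import all_boot all_order all_algebra.
From mathcomp Require Import all_classical all_reals all_analysis.
From mathcomp Require Import lra zify.

Set Implicit Arguments.
Unset Strict Implicit.
Unset Printing Implicit Defensive.

Import Order.TTheory GRing.Theory Num.Theory.

Local Open Scope classical_set_scope.
Local Open Scope ring_scope.

(** * Walks and distances *)

(** [dist] is an infimum over chains and the graph may be infinite, so no shortest chain is at hand.
    Upper bounds are therefore carried by explicit chains ([reach]), and lower bounds are proved for
    every chain, after shortening it to one that leaves [x] through a vertex, follows a walk of the
    graph and enters [y] through a vertex ([chain_cases]). Distances thus become linear arithmetic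
    in walk lengths and barycentric coordinates. The cycle is isometric because a short walk between
    two of its vertices, lifted and closed up along the cycle, would be a closed walk of nonzero
    winding and length less than n. Origin of 5/4: let a long side leave [x] through the end [b] of
    an edge [ab] and then reach [m]. As vertices are at distance at most 2, leaving through [a] is
    no worse than 2 steps, which forces [x] within 1/2 of [b], hence within 3/2 of [m]. A point
    between [x] and [m] farther than 5/4 from [x] is within 1/4 of [m], and within 5/4 of all
    neighbours of [m]. The extremal graphs are a triangle, an induced hexagon with three more
    vertices, an edge and a pentagon with chords, given by arcs with integer ends so that their
    properties can be computed. *)

Section Walks.
Variables (T : Type) (e : T -> T -> Prop).

(** The relation is arbitrary because walks are taken both for adjacency in the graph and for
    overlapping of lifted arcs. *)
Inductive walk : nat -> T -> T -> Prop :=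
| walk_nil u : walk 0 u u
| walk_cons k u v w : e u v -> walk k v w -> walk k.+1 u w.

Lemma walk0 u v : walk 0 u v -> u = v.
Proof.
move=> h; have: 0%N = 0%N by []; move: h.
by move E : {1 2}0%N => n h; case: h E.
Qed.

Lemma walkSP k u w : walk k.+1 u w -> exists2 v, e u v & walk k v w.
Proof.
move E : k.+1 => n h; case: h E => // m a b c eab h [->].
by exists b.
Qed.

Lemma walk1 u v : e u v -> walk 1 u v.
Proof. by move=> h; exact: walk_cons h (walk_nil v). Qed.

Lemma walk1P u v : walk 1 u v -> e u v.
Proof. by case/walkSP => w e1 /walk0 <-. Qed.

Lemma walk_cat k l u v w : walk k u v -> walk l v w -> walk (k + l) u w.
Proof.
move=> h; elim: h w l => {k u v} [u w l //|k u v v' euv _ IH w l h].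
by rewrite addSn; apply: walk_cons euv (IH _ _ h).
Qed.

Lemma walk_rev k u v :
  (forall a b, e a b -> e b a) -> walk k u v -> walk k v u.
Proof.
move=> es h; elim: h => {k u v} [u|k u v w euv _ IH]; first exact: walk_nil.
by rewrite -addn1; apply: walk_cat IH (walk1 (es _ _ euv)).
Qed.

Lemma walk_ge2 k u v : u <> v -> ~ e u v -> walk k u v -> (2 <= k)%N.
Proof. by move=> neq ne; case: k => [/walk0//|[/walk1P//|]]. Qed.

Lemma walk_ge1 k u v : u <> v -> walk k u v -> (1 <= k)%N.
Proof. by move=> neq; case: k => [/walk0//|]. Qed.

End Walks.

Section Realization.
Variables (R : realType) (V : Type) (G : graph V).
Implicit Types (x y z : V -> R) (u v w : V).

Local Notation edge := (@closed_edge R V).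
Local Notation vertex := (@vertex_point R V).

Lemma vertex_point_id v : vertex v v = 1.
Proof. by rewrite /vertex_point indicE mem_set. Qed.

Lemma vertex_point_neq v w : w <> v -> vertex v w = 0.
Proof. by move=> h; rewrite /vertex_point indicE memNset. Qed.

Lemma adj_neq u v : adj G u v -> u <> v.
Proof. by move=> h e; apply: (@adj_irrefl _ G v); rewrite -{1}e. Qed.

Lemma edge_pointl u v (t : R) : u <> v -> edge_point u v t u = 1 - t.
Proof.
by move=> n; rewrite /edge_point vertex_point_id vertex_point_neq // mulr0 addr0 mulr1.
Qed.

Lemma edge_pointr u v (t : R) : u <> v -> edge_point u v t v = t.
Proof.
move=> n; rewrite /edge_point vertex_point_id vertex_point_neq; last exact: nesym.
by rewrite mulr0 add0r mulr1.
Qed.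

Lemma edge_point_out u v (t : R) w : w <> u -> w <> v -> edge_point u v t w = 0.
Proof. by move=> nu nv; rewrite /edge_point !vertex_point_neq // !mulr0 addr0. Qed.

Lemma edge_point0 u v : edge_point u v (0 : R) = vertex u.
Proof. by apply/funext => w; rewrite /edge_point subr0 mul1r mul0r addr0. Qed.

Lemma edge_point1 u v : edge_point u v (1 : R) = vertex v.
Proof. by apply/funext => w; rewrite /edge_point subrr mul1r mul0r add0r. Qed.

Lemma edge_point_mem u v (t : R) : 0 <= t <= 1 -> edge u v (edge_point u v t).
Proof. by move=> h; exists t => //=; rewrite in_itv. Qed.

Lemma closed_edge_sym u v x : edge u v x -> edge v u x.
Proof.
case=> t /=; rewrite in_itv /= => /andP[t0 t1] <-; exists (1 - t).
  by rewrite /= in_itv /=; apply/andP; split; lra.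
apply/funext => w; rewrite /edge_point; lra.
Qed.

Lemma closed_edgel u v : edge u v (vertex u).
Proof. by rewrite -(edge_point0 u v); apply: edge_point_mem; rewrite lexx ler01. Qed.

Lemma closed_edger u v : edge u v (vertex v).
Proof. exact/closed_edge_sym/closed_edgel. Qed.

Lemma closed_edgeP u v x : u <> v -> edge u v x ->
  [/\ 0 <= x u, 0 <= x v, x u = 1 - x v & forall w, w <> u -> w <> v -> x w = 0].
Proof.
move=> n [t /=]; rewrite in_itv /= => /andP[t0 t1] <-.
rewrite edge_pointl // edge_pointr //; split; [lra| lra | lra | ].
by move=> w; exact: edge_point_out.
Qed.

Lemma closed_edgeE u v x : u <> v -> edge u v x -> x = edge_point u v (x v).
Proof. by move=> n [t _ <-]; rewrite edge_pointr. Qed.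

Lemma closed_edge_vertex u v x : u <> v -> edge u v x -> x u = 0 -> x = vertex v.
Proof.
move=> n e x0; have [_ _ h _] := closed_edgeP n e.
by rewrite (closed_edgeE n e) -(edge_point1 u v); congr edge_point; lra.
Qed.

Lemma closed_edge_supp u v x w : u <> v -> edge u v x -> x w <> 0 -> w = u \/ w = v.
Proof.
move=> n /(closed_edgeP n)[_ _ _ h] xw.
have [->|nu] := pselect (w = u); first by left.
have [->|nv] := pselect (w = v); first by right.
by case: xw; exact: h.
Qed.

Lemma edge_realization u v x : adj G u v -> edge u v x -> realization G x.
Proof. by move=> a e; right; exists u, v. Qed.

Lemma vertex_realization v : realization G (vertex v).
Proof. by left; exists v. Qed.

Lemma realization_supp x p : realization G x -> x p <> 0 ->
  x = vertex p \/ exists2 p', adj G p p' & edge p p' x.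
Proof.
case=> [[v ->]|[u [v [a e]]]] xp.
  have [->|n] := pselect (p = v); first by left.
  by rewrite vertex_point_neq in xp.
right; have [->|->] := closed_edge_supp (adj_neq a) e xp.
  by exists v.
by exists u; [exact: adj_sym | exact: closed_edge_sym].
Qed.

Lemma realization_ge0 x p : realization G x -> 0 <= x p.
Proof.
move=> rx; have [->//|xp] := pselect (x p = 0).
have [->|[q a e]] := realization_supp rx xp; first by rewrite vertex_point_id.
by have [] := closed_edgeP (adj_neq a) e.
Qed.

Lemma realization_le1 x p : realization G x -> x p <= 1.
Proof.
move=> rx; have [->//|xp] := pselect (x p = 0).
have [->|[q a e]] := realization_supp rx xp; first by rewrite vertex_point_id.
by have [? ? ? ?] := closed_edgeP (adj_neq a) e; lra.
Qed.

(** An actual chain rather than a bound on the infimum [dist]: such bounds compose by concatenation,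
    without epsilons. *)
Definition reach x y (r : R) := exists2 l, chain G x y l & l <= r.

Lemma chain_ge0 x y l : chain G x y l -> 0 <= l.
Proof. by elim=> // a b c u v m _ _ _ _ h; rewrite addr_ge0. Qed.

Lemma chain_cat x y z l m : chain G x y l -> chain G y z m -> chain G x z (l + m).
Proof.
move=> h; elim: h z m => {x y l} [x z m|x y z u v l a ex ey _ IH w m h].
  by rewrite add0r.
by rewrite -addrA; exact: chain_cons a ex ey (IH _ _ h).
Qed.

Lemma chain1 x y u v : adj G u v -> edge u v x -> edge u v y ->
  chain G x y `|x v - y v|.
Proof.
by move=> a ex ey; rewrite -[`|_|]addr0; exact: chain_cons a ex ey (chain_nil _ _).
Qed.

Lemma chain_sym x y l : chain G x y l -> chain G y x l.
Proof.
elim=> {x y l} [x|x y z u v l a ex ey _ IH]; first exact: chain_nil.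
by rewrite addrC distrC; apply: chain_cat IH _; exact: chain1 a ey ex.
Qed.

Lemma reach_refl x : reach x x 0.
Proof. by exists 0; first exact: chain_nil. Qed.

Lemma reach_le x y r s : reach x y r -> r <= s -> reach x y s.
Proof. by case=> l h lr rs; exists l => //; apply: le_trans rs. Qed.

Lemma reach_sym x y r : reach x y r -> reach y x r.
Proof. by case=> l h lr; exists l => //; exact: chain_sym. Qed.

Lemma reach_trans x y z r s : reach x y r -> reach y z s -> reach x z (r + s).
Proof.
case=> l h lr [m h' ms]; exists (l + m); first exact: chain_cat h h'.
exact: lerD.
Qed.

Lemma reach_edge x y u v : adj G u v -> edge u v x -> edge u v y ->
  reach x y `|x v - y v|.
Proof. by move=> a ex ey; exists `|x v - y v| => //; exact: (chain1 a). Qed.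

Lemma reach_endpoint x u v : adj G u v -> edge u v x -> reach x (vertex u) (1 - x u).
Proof.
move=> a ex; apply: reach_le (reach_edge a ex (closed_edgel u v)) _.
have [? ? h _] := closed_edgeP (adj_neq a) ex.
rewrite vertex_point_neq; last exact: nesym (adj_neq a).
rewrite subr0 ger0_norm; lra.
Qed.

Lemma reach_supp x p : realization G x -> x p <> 0 -> reach x (vertex p) (1 - x p).
Proof.
move=> rx xp; have [->|[q a e]] := realization_supp rx xp.
  by rewrite vertex_point_id subrr; exact: reach_refl.
exact: reach_endpoint a e.
Qed.

Lemma reach_walk k p q : walk (adj G) k p q -> reach (vertex p) (vertex q) k%:R.
Proof.
elim=> {k p q} [u|k u v w a _ IH]; first exact: reach_refl.
rewrite -natr1 addrC; apply: reach_trans IH.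
apply: reach_le (reach_endpoint (adj_sym a) (closed_edger v u)) _.
by rewrite vertex_point_neq ?subr0 //; exact: nesym (adj_neq a).
Qed.

Lemma reach_via x y p q k (r s : R) : reach x (vertex p) r -> reach y (vertex q) s ->
  walk (adj G) k p q -> reach x y (r + k%:R + s).
Proof.
move=> hx hy hw; apply: reach_trans (reach_sym hy).
exact: reach_trans hx (reach_walk hw).
Qed.

Lemma dist_reach x y r : reach x y r -> (dist G x y <= r%:E)%E.
Proof.
case=> l h lr; apply: (@le_trans _ _ l%:E); last by rewrite lee_fin.
by apply: ereal_inf_lbound; exists l.
Qed.

Lemma dist_sym x y : dist G x y = dist G y x.
Proof.
rewrite /dist; congr ereal_inf; apply/seteqP.
by split=> _ [l h <-]; exists l => //; exact: chain_sym.
Qed.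

Lemma dist_lt x y r : (dist G x y < r%:E)%E -> exists2 l, chain G x y l & l < r.
Proof. by case/ereal_inf_lt => _ [l h <-]; rewrite lte_fin => lr; exists l. Qed.

Lemma dist_ge x y r : (forall l, chain G x y l -> r <= l) -> (r%:E <= dist G x y)%E.
Proof.
by move=> h; apply: le_ereal_inf_tmp => _ [l hl <-]; rewrite lee_fin; exact: h.
Qed.

Lemma dist_eq_reach x y r s : dist G x y = r%:E -> reach x y s -> r <= s.
Proof. by move=> e /dist_reach; rewrite e lee_fin. Qed.

Lemma dist_eq_lt x y r e : dist G x y = r%:E -> 0 < e ->
  exists2 l, chain G x y l & l < r + e.
Proof. by move=> h e0; apply: dist_lt; rewrite h lte_fin ltrDl. Qed.

(** A segment in an edge changes only the coordinates of the two ends, by opposite amounts, so every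
    coordinate is 1-Lipschitz. *)
Lemma chain_coord x y l v : chain G x y l -> `|x v - y v| <= l.
Proof.
elim=> {x y l} [x|x y z u w l a ex ey _ IH]; first by rewrite subrr normr0.
apply: le_trans (ler_distD (y v) _ _) _; rewrite lerD //.
have n := adj_neq a.
have [? ? hx h] := closed_edgeP n ex; have [? ? hy h'] := closed_edgeP n ey.
have [->|nu] := pselect (v = u).
  by rewrite (_ : x u - y u = - (x w - y w)) ?normrN //; lra.
have [->//|nw] := pselect (v = w).
by rewrite h // h' // subrr normr0.
Qed.

Lemma dist_coord x y r v : dist G x y = r%:E -> `|x v - y v| <= r.
Proof.
move=> h; rewrite -lee_fin -h; apply: dist_ge => l; exact: chain_coord.
Qed.

(** With [via_vertices], the two shapes to which a chain can be shortened. The nonzero coordinates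
    say that both points are interior to the edge; in [via_vertices], [x p <> 0] says that [p] is
    [x] itself or an end of its edge, and [1 - x p] is the length of the way to [p]. *)
Definition same_edge x y (l : R) := exists u v,
  [/\ adj G u v, edge u v x, edge u v y, [/\ x u <> 0, x v <> 0, y u <> 0 & y v <> 0] &
      `|x v - y v| <= l].

Definition via_vertices x y (l : R) := exists p q k,
  [/\ x p <> 0, y q <> 0, walk (adj G) k p q & 1 - x p + k%:R + (1 - y q) <= l].

Lemma via_vertices_cons x y z u v l : adj G u v -> edge u v x -> edge u v y ->
  via_vertices y z l -> via_vertices x z (`|x v - y v| + l).
Proof.
move=> a ex ey [p [q [k [yp zq w h]]]]; have n := adj_neq a.
have xyp : `|x p - y p| = `|x v - y v|.
  have [_ _ hx _] := closed_edgeP n ex; have [_ _ hy _] := closed_edgeP n ey.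
  have [->|->//] := closed_edge_supp n ey yp.
  by rewrite (_ : x u - y u = - (x v - y v)) ?normrN //; lra.
(* If [p] is still a vertex of the edge of [x], the triangle inequality suffices. Otherwise [x] is
   the opposite end [p'], and the segment together with the way from [y] to [p] is the whole edge,
   one more step of the walk. *)
have [xp|xp] := pselect (x p = 0); last first.
  exists p, q, k; split=> //; rewrite -xyp.
  have := ler_norm (x p - y p); have := ler_norm (- (x p - y p)).
  by rewrite normrN => ? ?; lra.
have [p' [a' ex']] : exists p', adj G p' p /\ edge p' p x.
  have [->|->] := closed_edge_supp n ey yp; last by exists u.
  by exists v; split; [exact: adj_sym | exact: closed_edge_sym].
have [_ _ xp' _] := closed_edgeP (adj_neq a') ex'.
exists p', q, k.+1; split => //.
- by rewrite xp' xp subr0; exact/eqP/oner_neq0.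
- exact: walk_cons w.
- rewrite -xyp xp' xp -natr1; have := ler_norm (- (0 - y p)).
  by rewrite normrN => ?; lra.
Qed.

(** Every lower bound on a distance goes through this: a chain that ever touches a vertex can be
    replaced by a walk between vertices, and one that does not stays inside a single edge. *)
Lemma chain_cases x y l : realization G x -> chain G x y l ->
  same_edge x y l \/ via_vertices x y l.
Proof.
move=> rx h; elim: h rx => {x y l} [x|x y z u v l a ex ey _ IH _].
  case=> [[v ->]|[u [v [a e]]]].
    right; exists v, v, 0%N.
    rewrite vertex_point_id subrr !addr0; split=> //; try exact/eqP/oner_neq0.
    exact: walk_nil.
  have n := adj_neq a; have [? ? h _] := closed_edgeP n e.
  have [xu|xu] := pselect (x u = 0); last have [xv|xv] := pselect (x v = 0).
  - right; exists v, v, 0%N; split; [lra|lra|exact: walk_nil|lra].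
  - right; exists u, u, 0%N; split; [lra|lra|exact: walk_nil|lra].
  - by left; exists u, v; rewrite subrr normr0.
have [|[u' [v' [a' ey' ez [yu' yv' zu' zv'] h]]]|] := IH; first exact: edge_realization ey.
  have n := adj_neq a; have n' := adj_neq a'.
  (* Two nonzero coordinates of [y] determine its edge, so the edge of the tail is [uv], up to
     orientation. *)
  have {ez zu' zv' h} [ez zu zv h] :
      [/\ edge u v z, z u <> 0, z v <> 0 & `|y v - z v| <= l].
    have [e1|e1] := closed_edge_supp n ey yu';
      have [e2|e2] := closed_edge_supp n ey yv'; subst => //.
    split=> //; first exact: closed_edge_sym.
    have [_ _ h1 _] := closed_edgeP n' ey'; have [_ _ h2 _] := closed_edgeP n' ez.
    by move: h; rewrite (_ : y u - z u = - (y v - z v)) ?normrN //; lra.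
  have [? ? hx _] := closed_edgeP n ex; have [? ? hz _] := closed_edgeP n ez.
  have xz : `|x v - z v| <= `|x v - y v| + l.
    by apply: le_trans (ler_distD (y v) _ _) _; rewrite lerD2l.
  have [xu|xu] := pselect (x u = 0); last have [xv|xv] := pselect (x v = 0).
  - right; exists v, v, 0%N; split=> //; [lra|exact: walk_nil|].
    apply: le_trans xz; apply: le_trans (ler_norm _); lra.
  - right; exists u, u, 0%N; split=> //; [exact: walk_nil|].
    apply: le_trans xz; rewrite -normrN; apply: le_trans (ler_norm _); lra.
  - by left; exists u, v.
by move=> h; right; exact: via_vertices_cons a ex ey h.
Qed.

End Realization.

(** * Geodesic triangles *)

Section Hyperbolicity.
Variables (R : realType) (V : Type) (G : graph V).
Implicit Types (x y z : V -> R) (u v w : V).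

Local Notation edge := (@closed_edge R V).
Local Notation vertex := (@vertex_point R V).

Lemma mem_itv0 (L s : R) : (s \in `[0, L]) = (0 <= s <= L).
Proof. by rewrite in_itv. Qed.

Lemma geodesic_dist x y L g s : geodesic G x y L g -> 0 <= s <= L ->
  [/\ realization G (g s), dist G x (g s) = s%:E & dist G (g s) y = (L - s)%:E].
Proof.
case=> L0 g0 gL gr gd sL; have s0 : s \in `[0, L] by rewrite mem_itv0.
have i0 : 0 \in `[0, L] by rewrite mem_itv0 lexx.
have iL : L \in `[0, L] by rewrite mem_itv0 lexx L0.
case/andP: sL => s1 s2.
split; first exact: gr.
  by rewrite -g0 gd // sub0r normrN ger0_norm.
by rewrite -gL gd // distrC ger0_norm // subr_ge0.
Qed.

Lemma geodesic_ends x y L g : geodesic G x y L g ->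
  [/\ realization G x, realization G y, 0 <= L & dist G x y = L%:E].
Proof.
move=> gg; have [L0 g0 gL gr gd] := gg.
have i0 : 0 <= (0 : R) <= L by apply/andP.
have iL : 0 <= L <= L by apply/andP.
have [rx _ d] := geodesic_dist gg i0; have [ry _ _] := geodesic_dist gg iL.
by move: rx ry d; rewrite g0 gL subr0.
Qed.

Lemma geodesic_rev x y L g : geodesic G x y L g ->
  geodesic G y x L (fun s => g (L - s)).
Proof.
case=> L0 g0 gL gr gd.
have h (s : R) : s \in `[0, L] -> L - s \in `[0, L].
  by rewrite !in_itv /= => /andP[? ?]; apply/andP; split; lra.
split=> //; rewrite ?subr0 ?subrr //; first by move=> s /h; exact: gr.
move=> s t hs ht; rewrite gd ?h //.
by rewrite (_ : L - s - (L - t) = - (s - t)) ?normrN //; lra.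
Qed.

Lemma geodesic_side_ends x y S : geodesic_side G x y S -> S x /\ S y.
Proof.
case=> L [g [[L0 g0 gL _ _] ->]].
by split; [exists 0 | exists L] => //; rewrite /= in_itv /=; apply/andP.
Qed.

(** Rotating the triangle turns this single inclusion into the three of [thin]. *)
Lemma delta_le (D : R) :
  (forall x y z S1 S2 S3, geodesic_side G x y S1 -> geodesic_side G y z S2 ->
     geodesic_side G z x S3 -> S1 `<=` neighborhood G D (S2 `|` S3)) ->
  (delta R G <= D%:E)%E.
Proof.
move=> h; apply: ge_ereal_sup => _ [S1 [S2 [S3 [[x [y [z [h1 h2 h3]]]] ->]]]].
apply: ereal_inf_lbound; exists D => //; split.
- exact: h h1 h2 h3.
- exact: h h2 h3 h1.
- exact: h h3 h1 h2.
Qed.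

(** A point of a side of length at most [D] is within [D / 2] of one of its ends, and both ends lie
    on the other two sides. *)
Lemma delta_le_diam (D : R) :
  (forall x y, realization G x -> realization G y -> reach G x y D) ->
  (delta R G <= (D / 2)%:E)%E.
Proof.
move=> h; apply: delta_le => x y z S1 S2 S3 [L [g [gg ->]]] h2 h3 _ [s /= sL <-].
rewrite mem_itv0 in sL.
have [rx ry L0 dxy] := geodesic_ends gg; have [rs ds1 ds2] := geodesic_dist gg sL.
have LD := dist_eq_reach dxy (h _ _ rx ry).
have [_ xS3] := geodesic_side_ends h3; have [yS2 _] := geodesic_side_ends h2.
have [sD|sD] := leP s (D / 2).
  by exists x; [right | rewrite dist_sym ds1 lee_fin].
exists y; first by left.
by rewrite ds2 lee_fin; lra.
Qed.


Lemma delta_ge S1 S2 S3 p (r : R) : geodesic_triangle G S1 S2 S3 -> S1 p ->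
  (forall q l, (S2 `|` S3) q -> chain G p q l -> r <= l) -> (r%:E <= delta R G)%E.
Proof.
move=> tr S1p h; apply: (@le_trans _ _ (triangle_delta G S1 S2 S3)); last first.
  by apply: ereal_sup_ubound; exists S1, S2, S3.
apply: le_ereal_inf_tmp => _ [d [s1 _ _] <-]; rewrite lee_fin.
have [q Sq dpq] := s1 _ S1p.
by rewrite -lee_fin; apply: le_trans dpq; apply: dist_ge => l; exact: h.
Qed.

(** The degenerate side that makes a bigon a geodesic triangle. *)
Lemma geodesic_side_point x : realization G x -> geodesic_side G x x [set x].
Proof.
move=> rx; exists 0, (fun=> x); split.
  split=> // s t; rewrite !in_itv /= => /andP[s0 s1] /andP[t0 t1].
  have -> : s = 0 by lra.
  have -> : t = 0 by lra.
  rewrite subrr normr0; apply/eqP; rewrite eq_le; apply/andP; split.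
    exact/dist_reach/reach_refl.
  by apply: dist_ge => l; exact: chain_ge0.
by apply/seteqP; split=> [_ ->|_ [s _ <-] //]; exists 0; rewrite //= in_itv /= lexx.
Qed.

(** The vertex provides a triangle; the supremum over the empty family would be [-oo]. *)
Lemma delta_ge0 v : (0%:E <= delta R G)%E.
Proof.
have h := geodesic_side_point (vertex_realization R G v).
apply: (@delta_ge [set vertex v] [set vertex v] [set vertex v] (vertex v)) => //.
  by exists (vertex v), (vertex v), (vertex v).
by move=> q l _; exact: chain_ge0.
Qed.

Lemma realization_near x : realization G x ->
  exists2 p, x p <> 0 & 1 - x p <= 1 / 2.
Proof.
case=> [[v ->]|[u [v [a e]]]].
  by exists v; rewrite vertex_point_id; [exact/eqP/oner_neq0 | lra].
have [? ? h _] := closed_edgeP (adj_neq a) e.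
by have [?|?] := leP (1 / 2) (x u); [exists u | exists v]; lra.
Qed.

(** Each of the two points is within 1/2 of a vertex, whence the extra 1. *)
Lemma realization_diam m : (forall u v, exists2 k, walk (adj G) k u v & (k <= m)%N) ->
  forall x y, realization G x -> realization G y -> reach G x y (m%:R + 1).
Proof.
move=> h x y rx ry; have [p xp p2] := realization_near rx.
have [q yq q2] := realization_near ry; have [k w km] := h p q.
apply: reach_le (reach_via (reach_supp rx xp) (reach_supp ry yq) w) _.
move: km; rewrite -(ler_nat R) => ?; lra.
Qed.

(** A shortcut between two points of a 1-Lipschitz path would be a shortcut between its ends, so the
    length of the whole path is the only lower bound to check. *)
Lemma geodesic_of_lip (g : R -> V -> R) (L : R) : 0 <= L ->
  (forall s : R, 0 <= s <= L -> realization G (g s)) ->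
  (forall s t : R, 0 <= s -> s <= t -> t <= L -> reach G (g s) (g t) (t - s)) ->
  (forall l, chain G (g 0) (g L) l -> L <= l) ->
  geodesic G (g 0) (g L) L g.
Proof.
move=> L0 gr glip gL; split=> //.
suff h s t : 0 <= s -> s <= t -> t <= L -> dist G (g s) (g t) = (t - s)%:E.
  move=> s t; rewrite !in_itv /= => /andP[s0 s1] /andP[t0 t1].
  have [st|ts] := leP s t; first by rewrite h // distrC ger0_norm // subr_ge0.
  by rewrite dist_sym h ?(ltW ts) // ger0_norm // subr_ge0 ltW.
move=> s0 st tL; apply/eqP; rewrite eq_le; apply/andP; split.
  exact/dist_reach/glip.
apply: dist_ge => l hl.
have [l1 h1 l1s] := glip 0 s (lexx _) s0 (le_trans st tL).
have [l2 h2 l2s] := glip t L (le_trans s0 st) tL (lexx _).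
have := gL _ (chain_cat h1 (chain_cat hl h2)); lra.
Qed.

(** Walks are infinite sequences here, and closed walks periodic ones, so arc length is never
    reduced modulo the period. *)
Definition path_point (w : nat -> V) (s : R) : V -> R :=
  edge_point (w (Num.truncn s)) (w (Num.truncn s).+1) (s - (Num.truncn s)%:R).

Section Paths.
Variable w : nat -> V.
Hypothesis w_adj : forall i, adj G (w i) (w i.+1).

(** At the right end [truncn] has already moved to the next edge, but both formulas give the vertex
    [w i.+1]; closed intervals allow case splits at integers. *)
Lemma path_pointE i s : i%:R <= s <= i.+1%:R ->
  path_point w s = edge_point (w i) (w i.+1) (s - i%:R).
Proof.
move=> /andP[is1]; rewrite le_eqVlt => /orP[/eqP->|is2].
  rewrite /path_point natrK subrr edge_point0 -natr1.
  by rewrite (_ : i%:R + 1 - i%:R = 1) ?edge_point1 //; lra.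
by rewrite /path_point (@truncn_def _ s i) // is1 is2.
Qed.

Lemma path_point_edge i s : i%:R <= s <= i.+1%:R ->
  edge (w i) (w i.+1) (path_point w s).
Proof.
move=> h; rewrite (path_pointE h); apply: edge_point_mem.
move: h; rewrite -natr1 => /andP[? ?]; apply/andP; split; lra.
Qed.

Lemma path_point_coordl i s : i%:R <= s <= i.+1%:R -> path_point w s (w i) = i.+1%:R - s.
Proof.
move=> h; rewrite (path_pointE h) edge_pointl -?natr1; first lra.
exact: adj_neq (w_adj i).
Qed.

Lemma path_point_coordr i s : i%:R <= s <= i.+1%:R -> path_point w s (w i.+1) = s - i%:R.
Proof.
by move=> h; rewrite (path_pointE h) edge_pointr //; exact: adj_neq (w_adj i).
Qed.

Lemma path_point_cases i s : i%:R <= s <= i.+1%:R ->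
  [/\ path_point w s (w i) = i.+1%:R - s, path_point w s (w i.+1) = s - i%:R &
      forall p, path_point w s p <> 0 -> p = w i \/ p = w i.+1].
Proof.
move=> h; split; [exact: path_point_coordl | exact: path_point_coordr |].
by move=> p; apply: closed_edge_supp (path_point_edge h); exact: adj_neq (w_adj _).
Qed.

Lemma path_point_nat i : path_point w i%:R = vertex (w i).
Proof. by rewrite (@path_pointE i) ?subrr ?edge_point0 // lexx ler_nat leqnSn. Qed.

Lemma truncn_le (s : R) : 0 <= s -> (Num.truncn s)%:R <= s <= (Num.truncn s).+1%:R.
Proof. by move=> /truncn_itv /andP[-> /ltW]. Qed.

Lemma path_point_realization s : 0 <= s -> realization G (path_point w s).
Proof. by move=> /truncn_le /path_point_edge; apply: edge_realization. Qed.

Lemma path_point_lip (s t : R) : 0 <= s -> s <= t ->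
  reach G (path_point w s) (path_point w t) (t - s).
Proof.
move=> s0 st; have := truncn_le (le_trans s0 st); move: (Num.truncn t).+1 => n /andP[_].
elim: n s t s0 st => [|n IH] s t s0 st tn.
  rewrite mulr0n in tn; have -> : s = t by lra.
  by rewrite subrr; exact: reach_refl.
have step (r : R) : n%:R <= r -> r <= t ->
    reach G (path_point w r) (path_point w t) (t - r).
  move=> nr rt; have hr : n%:R <= r <= n.+1%:R by rewrite nr (le_trans rt).
  have ht : n%:R <= t <= n.+1%:R by rewrite (le_trans nr).
  apply: reach_le (reach_edge (w_adj n) (path_point_edge hr) (path_point_edge ht)) _.
  rewrite !path_point_coordr //. rewrite distrC ger0_norm; lra.
have [nt|nt] := leP n%:R t; last exact: IH (ltW nt).
have [ns|ns] := leP n%:R s; first exact: step.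
apply: reach_le (reach_trans (IH _ _ s0 (ltW ns) (lexx _)) (step _ (lexx _) nt)) _.
lra.
Qed.

End Paths.

(* Two points cut a closed walk of length n into two halves of length n / 2; if
   they are at distance n / 2, both halves are geodesics and form a bigon. *)
Lemma delta_ge_bigon (w : nat -> V) (n : nat) (t0 r : R) :
  0 <= t0 -> (forall i, adj G (w i) (w i.+1)) -> (forall i, w (i + n)%N = w i) ->
  (forall l, chain G (path_point w t0) (path_point w (t0 + n%:R / 2)) l ->
     n%:R / 2 <= l) ->
  (forall t l, t0 + n%:R / 2 <= t -> t <= t0 + n%:R ->
     chain G (path_point w (t0 + n%:R / 4)) (path_point w t) l -> r <= l) ->
  (r%:E <= delta R G)%E.
Proof.
move=> t00 wa wn hL hr; have n0 : 0 <= n%:R :> R by [].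
have per : path_point w (t0 + n%:R) = path_point w t0.
  have h := truncn_le t00; move: (Num.truncn t0) h => i h.
  rewrite (@path_pointE w (i + n) (t0 + n%:R)) ?(path_pointE w h).
    by rewrite -addSn !wn natrD; congr edge_point; lra.
  by move: h; rewrite -addSn !natrD !lerD2r.
have side (a b : R) : 0 <= a -> b = a + n%:R / 2 ->
    (forall l, chain G (path_point w a) (path_point w b) l -> n%:R / 2 <= l) ->
    geodesic G (path_point w a) (path_point w b) (n%:R / 2)
      (fun s => path_point w (a + s)).
  move=> a0 -> h; have := @geodesic_of_lip (fun s => path_point w (a + s)) (n%:R / 2).
  rewrite addr0; apply.
  - by rewrite divr_ge0.
  - by move=> s /andP[s0 _]; apply: path_point_realization => //; rewrite addr_ge0.
  - move=> s t s0 st _; have -> : t - s = a + t - (a + s) by lra.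
    by apply: path_point_lip => //; [rewrite addr_ge0 | rewrite lerD2l].
  - exact: h.
have g1 := side t0 _ t00 erefl hL.
have g2 : geodesic G (path_point w (t0 + n%:R / 2)) (path_point w t0) (n%:R / 2)
    (fun s => path_point w (t0 + n%:R / 2 + s)).
  rewrite -per; apply: side; [lra|lra|] => l; rewrite per => /chain_sym; exact: hL.
(* The third side is a point, and the point tested is the midpoint of the first half. *)
apply: (@delta_ge _ _ [set path_point w t0] (path_point w (t0 + n%:R / 4))).
- exists (path_point w t0), (path_point w (t0 + n%:R / 2)), (path_point w t0); split.
  + by exists (n%:R / 2), (fun s => path_point w (t0 + s)).
  + by exists (n%:R / 2), (fun s => path_point w (t0 + n%:R / 2 + s)).
  + exact/geodesic_side_point/path_point_realization.
- by exists (n%:R / 4) => //=; rewrite in_itv /=; apply/andP; split; lra.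
- move=> q l [[s /=]|->].
    by rewrite in_itv /= => /andP[s0 s1] <-; apply: hr; lra.
  by rewrite -per; apply: hr; lra.
Qed.

End Hyperbolicity.

(** * Graphs of diameter two *)

Section TwoThin.
Variables (R : realType) (V : Type) (G : graph V).
Implicit Types (x y z : V -> R) (u v w : V).

Local Notation edge := (@closed_edge R V).
Local Notation vertex := (@vertex_point R V).

Let lt00 : (0 : R) < 0 -> False.
Proof. by rewrite ltxx. Qed.

Lemma realization_edge x a b : realization G x -> a <> b -> x a <> 0 -> x b <> 0 ->
  adj G a b /\ edge a b x.
Proof.
move=> rx n xa xb; have [e|[q ad e]] := realization_supp rx xa.
  by case: xb; rewrite e vertex_point_neq //; exact: nesym.
by have [e'|->//] := closed_edge_supp (adj_neq ad) e xb; case: n.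
Qed.

Lemma realization_eq1 x a : realization G x -> x a = 1 -> x = vertex a.
Proof.
move=> rx xa; have xa0 : x a <> 0 by rewrite xa; exact/eqP/oner_neq0.
have [//|[q ad e]] := realization_supp rx xa0.
apply: (closed_edge_vertex (nesym (adj_neq ad)) (closed_edge_sym e)).
by have [_ _ h _] := closed_edgeP (adj_neq ad) e; lra.
Qed.

(** Coordinates are continuous along a geodesic. At the supremum of the times up to which both stay
    nonzero, one of them must vanish, and the geodesic is at an end of the edge. *)
Lemma geodesic_exit x y L g a b : a <> b -> geodesic G x y L g ->
  x a <> 0 -> x b <> 0 -> y a = 0 \/ y b = 0 ->
  exists2 s, 0 <= s <= L & g s = vertex a \/ g s = vertex b.
Proof.
move=> nab gg xa xb yab; have [L0 g0 gL _ gd] := gg.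
have lip (s t : R) v : 0 <= s <= L -> 0 <= t <= L -> `|g s v - g t v| <= `|s - t|.
  by move=> hs ht; apply: (@dist_coord R V G); rewrite gd ?mem_itv0.
have gr (s : R) : 0 <= s <= L -> realization G (g s).
  by move=> hs; have [] := geodesic_dist gg hs.
pose E := [set s : R | 0 <= s <= L /\
  forall r : R, 0 <= r <= s -> g r a <> 0 /\ g r b <> 0].
have E0 : E 0.
  split; first exact/andP.
  move=> r /andP[r0 r1]; have -> : r = 0 by lra.
  by rewrite g0.
have EL (s : R) : E s -> s <= L by case=> /andP[].
have hsE : has_sup E by split; [exists 0 | exists L].
pose m := sup E.
have m0 : 0 <= m by exact: sup_upper_bound.
have mL : m <= L by apply: ge_sup; [exists 0 |].
have hm : 0 <= m <= L by apply/andP.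
have below (r : R) : 0 <= r -> r < m -> g r a <> 0 /\ g r b <> 0.
  move=> r0 rm; have mr : 0 < m - r by rewrite subr_gt0.
  have [t [_ tE]] := sup_adherent mr hsE; rewrite -/m => rt.
  by apply: tE; apply/andP; split=> //; lra.
(* The sum is 1 inside the edge, hence in the limit; once one coordinate vanishes, the other is
   1. *)
have sum1 : g m a + g m b = 1.
  apply/eqP; rewrite -subr_eq0 -normr_le0; apply/ler_addgt0Pr => t t0.
  have t2 : 0 < t / 2 by lra.
  have [e Ee] := sup_adherent t2 hsE; rewrite -/m => me.
  have em : e <= m by exact: sup_upper_bound.
  have [he Eer] := Ee; case/andP: (he) => e0 _.
  have [ea eb] : g e a <> 0 /\ g e b <> 0 by apply: Eer; apply/andP.
  have [ad ed] := realization_edge (gr _ he) nab ea eb.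
  have [_ _ e1 _] := closed_edgeP nab ed.
  have := lip m e a hm he; have := lip m e b hm he.
  rewrite (ger0_norm (_ : 0 <= m - e)) ?subr_ge0 // !ler_norml.
  by move=> /andP[? ?] /andP[? ?]; apply/andP; split; lra.
exists m => //; have rm := gr _ hm.
have [ma|ma] := pselect (g m a = 0).
  by right; apply: realization_eq1 => //; lra.
have [mb|mb] := pselect (g m b = 0).
  by left; apply: realization_eq1 => //; lra.
have mLt : m < L.
  rewrite lt_neqAle mL andbT; apply/eqP => e; move: ma mb; rewrite e gL.
  by case: yab.
have ga : 0 < g m a by rewrite lt_neqAle (realization_ge0 a rm) andbT eq_sym; exact/eqP.
have gb : 0 < g m b by rewrite lt_neqAle (realization_ge0 b rm) andbT eq_sym; exact/eqP.
(* If both coordinates were positive at [m], being 1-Lipschitz they would stay positive for a time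
   [d], past the supremum. *)
pose d : R := Num.min (L - m) (Num.min (g m a) (g m b) / 2).
have [d0 d1 d2 d3] : [/\ 0 < d, d <= L - m, d <= g m a / 2 & d <= g m b / 2].
  split.
  - by rewrite lt_min subr_gt0 mLt divr_gt0 // lt_min ga gb.
  - by rewrite ge_min lexx.
  - by rewrite ge_min ler_pM2r ?invr_gt0 // ge_min lexx orbT.
  - by rewrite ge_min ler_pM2r ?invr_gt0 // ge_min lexx !orbT.
suff hE : E (m + d).
  by have : m + d <= m := sup_upper_bound hsE hE; rewrite gerDl leNgt d0.
split; first by apply/andP; split; lra.
move=> r /andP[r0 rd]; have [rm'|mr] := ltP r m; first exact: below.
have hr : 0 <= r <= L by apply/andP; split; lra.
have := lip r m a hr hm; have := lip r m b hr hm.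
rewrite (ger0_norm (_ : 0 <= r - m)) ?subr_ge0 // !ler_norml.
by move=> /andP[? ?] /andP[? ?]; split; lra.
Qed.

Hypothesis diam2 : forall u v, exists2 k, walk (adj G) k u v & (k <= 2)%N.

(** Points more than 1 apart lie in no common edge, so an almost shortest chain passes through
    vertices; [e] pays for the infimum. *)
Lemma dist_via_gt1 x y (r e : R) : realization G x -> realization G y ->
  dist G x y = r%:E -> 1 < r -> 0 < e ->
  exists p q k, [/\ x p <> 0, y q <> 0, walk (adj G) k p q &
                    1 - x p + k%:R + (1 - y q) < r + e].
Proof.
move=> rx ry d r1 e0; have [l hl lr] := dist_eq_lt d e0.
have [[u [v [a ex ey _ _]]]|[p [q [k [xp yq w h]]]]] := chain_cases rx hl.
  have := dist_eq_reach d (reach_edge a ex ey); rewrite leNgt.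
  have [? ? ? _] := closed_edgeP (adj_neq a) ex.
  have [? ? ? _] := closed_edgeP (adj_neq a) ey.
  by rewrite ltr_norml; case/negP; apply/andP; split; lra.
by exists p, q, k; split=> //; apply: le_lt_trans lr.
Qed.

(* The configuration at distance more than 5/4 from both ends of a side: the
   side runs from the edge ab through b, m, c to the edge cd. *)
Lemma long_side x y (p : V -> R) (s t : R) :
  realization G x -> realization G y -> realization G p ->
  dist G x p = s%:E -> dist G p y = t%:E -> dist G x y = (s + t)%:E ->
  5 / 4 < s -> 5 / 4 < t ->
  exists a b m c d, [/\ adj G b m /\ adj G m c,
    reach G p (vertex m) (1 / 4),
    [/\ a <> b, x a <> 0, x b <> 0 & y a = 0 \/ y b = 0],
    [/\ d <> c, y d <> 0, y c <> 0 & x d = 0 \/ x c = 0] &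
    forall k, walk (adj G) k a d -> (2 <= k)%N].
Proof.
move=> rx ry rp dxp dpy dxy s54 t54.
(* The error allowed in almost shortest chains, a quarter of the excess over 5/4, so that a few such
   errors still fit. *)
pose e : R := Num.min (s - 5 / 4) (t - 5 / 4) / 4.
have [e0 se te] : [/\ 0 < e, 5 / 4 + 4 * e <= s & 5 / 4 + 4 * e <= t].
  have e0 : 0 < e by rewrite divr_gt0 // lt_min !subr_gt0 s54.
  have : 4 * e <= s - 5 / 4 by rewrite /e mulrC divfK // ge_min lexx.
  have : 4 * e <= t - 5 / 4 by rewrite /e mulrC divfK // ge_min lexx orbT.
  by split=> //; lra.
have s1 : 1 < s by lra.
have t1 : 1 < t by lra.
have [b [m1 [k [xb pm1 wk hk]]]] := dist_via_gt1 rx rp dxp s1 e0.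
have [m2 [c [l [pm2 yc wl hl]]]] := dist_via_gt1 rp ry dpy t1 e0.
have xb1 := realization_le1 b rx; have xb0 := realization_ge0 b rx.
have yc1 := realization_le1 c ry; have yc0 := realization_ge0 c ry.
have up a d r r' : reach G x (vertex a) r -> reach G y (vertex d) r' ->
    s + t <= r + 2 + r'.
  move=> ra rd; have [j w j2] := diam2 a d.
  have := dist_eq_reach dxy (reach_via ra rd w).
  by move: j2; rewrite -(ler_nat R) => ?; lra.
have rxb := reach_supp rx xb; have ryc := reach_supp ry yc.
have upbc := up _ _ _ _ rxb ryc.
(* The other end [a] of the edge of [x], at distance [x b], serves for detours to compare with;
   [eyd] does the same for [y]. *)
have exa : 1 - x b > 0 -> exists a, [/\ a <> b, adj G a b, edge a b x, x a = 1 - x b &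
    reach G x (vertex a) (x b)].
  move=> h; have [E|[a ab ex]] := realization_supp rx xb.
    by move: h; rewrite E vertex_point_id; lra.
  have [_ _ h' _] := closed_edgeP (adj_neq ab) ex.
  exists a; split; [exact: nesym (adj_neq ab)|exact: adj_sym|exact: closed_edge_sym|lra|].
  by apply: reach_le (reach_endpoint (adj_sym ab) (closed_edge_sym ex)) _; lra.
have eyd : 1 - y c > 0 -> exists d, [/\ d <> c, adj G d c, edge d c y, y d = 1 - y c &
    reach G y (vertex d) (y c)].
  move=> h; have [E|[d cd ey]] := realization_supp ry yc.
    by move: h; rewrite E vertex_point_id; lra.
  have [_ _ h' _] := closed_edgeP (adj_neq cd) ey.
  exists d; split; [exact: nesym (adj_neq cd)|exact: adj_sym|exact: closed_edge_sym|lra|].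
  by apply: reach_le (reach_endpoint (adj_sym cd) (closed_edge_sym ey)) _; lra.
have [m [bm mc rm fe ff]] : exists m, [/\ adj G b m, adj G m c,
    reach G p (vertex m) (1 / 4), 1 - x b < 1 / 2 + e & 1 - y c < 1 / 2 + e].
  (* The detour through [a] and [d] gives [s + t <= x b + 2 + y c]; adding both bounds yields
     [s + t <= 5 / 2]. *)
  have short : s + t <= 1 - x b + 1 + (1 - y c) -> False.
    move=> h; have [|a [_ _ _ _ ra]] := exa; first lra.
    have [|d [_ _ _ _ rd]] := eyd; first lra.
    by have := up _ _ _ _ ra rd; lra.
  (* Compared with leaving through [a], of length at most [x b + 2 + (1 - y c)], this forces
     [1 - x b < 1 / 2 + e]; symmetrically for [y]. *)
  have half : s + t > 1 - x b + 2 + (1 - y c) - 2 * e ->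
      1 - x b < 1 / 2 + e /\ 1 - y c < 1 / 2 + e.
    move=> h; split; rewrite ltNge; apply/negP => h'.
      have [|a [_ _ _ _ ra]] := exa; first lra.
      by have := up _ _ _ _ ra ryc; lra.
    have [|d [_ _ _ _ rd]] := eyd; first lra.
    by have := up _ _ _ _ rxb rd; lra.
  have pm1p := reach_supp rp pm1; have pm2p := reach_supp rp pm2.
  have s_up j : walk (adj G) j b m1 -> s <= 1 - x b + j%:R + (1 - p m1).
    by move=> w; exact: dist_eq_reach dxp (reach_via rxb pm1p w).
  have t_up j : walk (adj G) j m2 c -> t <= 1 - p m2 + j%:R + (1 - y c).
    by move=> w; exact: dist_eq_reach dpy (reach_via pm2p ryc w).
  (* If both chains use the same vertex near [p], that vertex is [m] and both walks have length
     1. *)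
  have [E|n] := pselect (m1 = m2).
    subst m2; have L := dist_eq_reach dxy (reach_via rxb ryc (walk_cat wk wl)).
    move: (s_up k wk) (t_up l wl) hk hl L; rewrite natrD => su tu hk hl L.
    have p1 := realization_le1 m1 rp.
    have kl2 : (k + l < 3)%N by rewrite -(ltr_nat R) natrD; lra.
    case: k l wk wl kl2 hk hl L su tu => [|[|[|k]]] [|[|[|l]]] // wk wl _ hk hl L su tu;
      rewrite ?mulr0n ?mulr1n in hk hl L su tu.
    - case: lt00; lra.
    - by case: short; lra.
    - case: lt00; have [] := half; lra.
    - by case: short; lra.
    - have [] := half; first lra.
      move=> h1 h2; exists m1; split=> //; first exact: walk1P.
        exact: walk1P.
      by apply: reach_le pm1p _; lra.
    - case: lt00; have [] := half; lra.
  (* Now [p] is inside the edge from [m1] to [m2], one of which is [b] or [c] and the other is [m].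
     If it is [b], then [p] is at least 3/4 beyond [b], because [s] exceeds 5/4 and [x] is within
     about 1/2 of [b]; hence the 1/4. *)
  have [ad ed] := realization_edge rp n pm1 pm2.
  have [_ _ p12 _] := closed_edgeP n ed.
  have L := dist_eq_reach dxy (reach_via rxb ryc (walk_cat wk (walk_cons ad wl))).
  move: (s_up k wk) (t_up l wl) hk hl L; rewrite natrD -natr1 => su tu hk hl L.
  have kl2 : (k + l < 2)%N by rewrite -(ltr_nat R) natrD; lra.
  case: k l wk wl kl2 hk hl L su tu => [|[|k]] [|[|l]] // wk wl _ hk hl L su tu;
      rewrite ?mulr0n ?mulr1n in hk hl L su tu.
  - by case: short; lra.
  - have [] := half; first lra.
    move=> h1 h2; exists m2; split=> //; last by apply: reach_le pm2p _; lra.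
      by rewrite (walk0 wk).
    exact: walk1P.
  - have [] := half; first lra.
    move=> h1 h2; exists m1; split=> //; last by apply: reach_le pm1p _; lra.
      exact: walk1P.
    by rewrite -(walk0 wl).
have [|a [nab ab exab xa ra]] := exa; first lra.
have [|d [ndc dc eydc yd rd]] := eyd; first lra.
have one q r : 0 <= q <= 1 -> 0 <= r <= 1 -> `|q - r| <= 1 :> R.
  by move=> /andP[? ?] /andP[? ?]; rewrite ler_norml; apply/andP; split; lra.
have cx v : 0 <= x v <= 1 by rewrite (realization_ge0 v rx) (realization_le1 v rx).
have cy v : 0 <= y v <= 1 by rewrite (realization_ge0 v ry) (realization_le1 v ry).
exists a, b, m, c, d; split=> //.
- split=> //; first lra.
  have [?|ya] := pselect (y a = 0); first by left.
  right; have [//|yb] := pselect (y b = 0).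
  have [_ ey] := realization_edge ry nab ya yb.
  by have := dist_eq_reach dxy (reach_edge ab exab ey); have := one _ _ (cx b) (cy b); lra.
- split=> //; first lra.
  have [?|xd] := pselect (x d = 0); first by left.
  right; have [//|xc] := pselect (x c = 0).
  have [_ ex] := realization_edge rx ndc xd xc.
  by have := dist_eq_reach dxy (reach_edge dc ex eydc); have := one _ _ (cx c) (cy c); lra.
(* With a walk of length at most 1, [s + t <= x b + 1 + y c]; added to [upbc], this gives
   [s + t <= 5 / 2]. *)
- move=> j w; rewrite -(ltr_nat R) ltNge; apply/negP => j1.
  by have := dist_eq_reach dxy (reach_via ra rd w); lra.
Qed.

Lemma delta_le_54 :
  (forall u v w, u <> v -> u <> w -> v <> w ->
     ~ adj G u v -> ~ adj G u w -> ~ adj G v w -> False) ->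
  (delta R G <= (5 / 4)%:E)%E.
Proof.
move=> indep; apply: delta_le => x y z S1 S2 S3 [L [g [gg ->]]] h2 h3 _ [s /= sL <-].
rewrite mem_itv0 in sL.
have [rx ry L0 dxy] := geodesic_ends gg; have [rs ds1 ds2] := geodesic_dist gg sL.
have [_ xS3] := geodesic_side_ends h3; have [yS2 _] := geodesic_side_ends h2.
have [s54|s54] := leP s (5 / 4).
  by exists x; [right | rewrite dist_sym ds1 lee_fin].
have [t54|t54] := leP (L - s) (5 / 4); first by exists y; [left | rewrite ds2 lee_fin].
have dxy' : dist G x y = (s + (L - s))%:E by rewrite addrCA subrr addr0.
have [a [b [m [c [d [[bm mc] rm [nab xa xb yab] [ndc yd yc xdc] wad]]]]]] :=
  long_side rx ry rs ds1 ds2 dxy' s54 t54.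
have [L2 [g2 [gg2 S2E]]] := h2; have [L3 [g3 [gg3 S3E]]] := h3.
have in2 (r : R) : 0 <= r <= L2 -> S2 (g2 r).
  by move=> hr; rewrite S2E; exists r => //=; rewrite in_itv.
have in3 (r : R) : 0 <= r <= L3 -> S3 (g3 r).
  by move=> hr; rewrite S3E; exists r => //=; rewrite in_itv.
(* The other two sides join [x] and [y] through [z]. One of [x] and [y] is interior to the edge [uv]
   and the other is not, so one of these sides leaves the edge; the position of [z] tells which. *)
have side_exit u v : u <> v ->
    (x u <> 0 /\ x v <> 0 /\ (y u = 0 \/ y v = 0)) \/
    (y u <> 0 /\ y v <> 0 /\ (x u = 0 \/ x v = 0)) ->
    exists q, (q = u \/ q = v) /\ (S2 `|` S3) (vertex q).
  move=> nuv h.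
  have ext q : q = vertex u \/ q = vertex v -> (S2 `|` S3) q ->
      exists q, (q = u \/ q = v) /\ (S2 `|` S3) (vertex q).
    by case=> -> Sq; [exists u | exists v]; split=> //; [left | right].
  have gr2 := geodesic_rev gg2; have gr3 := geodesic_rev gg3.
  have [zu|zu] := pselect (z u = 0 \/ z v = 0).
    case: h => [[hu [hv _]]|[hu [hv _]]].
      have [r hr e] := geodesic_exit nuv gr3 hu hv zu.
      by apply: ext e _; right; apply: in3; case/andP: hr => ? ?; apply/andP; split; lra.
    have [r hr e] := geodesic_exit nuv gg2 hu hv zu.
    by apply: ext e _; left; exact: in2.
  have zu' : z u <> 0 by move=> e; apply: zu; left.
  have zv' : z v <> 0 by move=> e; apply: zu; right.
  case: h => [[_ [_ h]]|[_ [_ h]]].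
    have [r hr e] := geodesic_exit nuv gr2 zu' zv' h.
    by apply: ext e _; left; apply: in2; case/andP: hr => ? ?; apply/andP; split; lra.
  have [r hr e] := geodesic_exit nuv gg3 zu' zv' h.
  by apply: ext e _; right; exact: in3.
(* 1/4 to [m] and at most 1 more to [q]. *)
have close q : q = m \/ adj G m q -> (S2 `|` S3) (vertex q) ->
    neighborhood G (5 / 4) (S2 `|` S3) (g s).
  move=> h Sq; exists (vertex q) => //; apply: dist_reach.
  case: h => [->|e]; first by apply: reach_le rm _; lra.
  by apply: reach_le (reach_trans rm (reach_walk R (walk1 e))) _; lra.
have [q1 [hq1 Sq1]] := side_exit a b nab (or_introl (conj xa (conj xb yab))).
have [q2 [hq2 Sq2]] := side_exit d c ndc (or_intror (conj yd (conj yc xdc))).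
have [n1|n1] := pselect (q1 = m \/ adj G m q1); first exact: close n1 Sq1.
have [n2|n2] := pselect (q2 = m \/ adj G m q2); first exact: close n2 Sq2.
have e1 : q1 = a by case: hq1 => // E; case: n1; right; rewrite E; exact: adj_sym.
have e2 : q2 = d by case: hq2 => // E; case: n2; right; rewrite E.
subst q1 q2; exfalso; apply: (indep m a d) => //.
- by move=> E; apply: n1; left.
- by move=> E; apply: n2; left.
- by move=> E; have := wad 0%N; rewrite E => /(_ (walk_nil _ _)).
- by move=> E; apply: n1; right.
- by move=> E; apply: n2; right.
- by move=> e; have := wad _ (walk1 e).
Qed.

End TwoThin.

(** * Lifts of arcs to the line *)

Section Lifts.
Variables (R : realType) (V : Type) (a b : V -> R) (tau : R).
Implicit Types (p q : V * int) (z : int) (t : R).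

(* [(v, z)] is the lift [a v + z tau, b v + z tau] of the arc of v to the
   universal cover of the circle R / tau Z. *)
Definition lo p : R := a p.1 + tau * p.2%:~R.
Definition hi p : R := b p.1 + tau * p.2%:~R.
Definition shift z p : V * int := (p.1, p.2 + z).
Definition overlap p q := lo p <= hi q /\ lo q <= hi p.
Definition covers k (f : 'I_k -> V) :=
  forall t, exists i z, lo (f i, z) <= t <= hi (f i, z).

Lemma lo_shift z p : lo (shift z p) = lo p + tau * z%:~R.
Proof. by rewrite /lo /= intrD mulrDr addrA. Qed.

Lemma hi_shift z p : hi (shift z p) = hi p + tau * z%:~R.
Proof. by rewrite /hi /= intrD mulrDr addrA. Qed.

Lemma shift0 p : shift 0 p = p.
Proof. by case: p => u z; rewrite /shift /= addr0. Qed.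

Lemma shiftD z z' p : shift z (shift z' p) = shift (z' + z) p.
Proof. by rewrite /shift /= addrA. Qed.

Lemma overlap_sym p q : overlap p q -> overlap q p.
Proof. by case. Qed.

Lemma overlap_shift z p q : overlap p q -> overlap (shift z p) (shift z q).
Proof. by rewrite /overlap !lo_shift !hi_shift !lerD2r. Qed.

Hypothesis tau_gt0 : 0 < tau.
Hypothesis a_range : forall v, 0 <= a v < tau.
Hypothesis le_ab : forall v, a v <= b v.
Hypothesis hi_mono : forall p q, lo p <= lo q -> hi p <= hi q.
(** Of two arcs with the same left end, one would contain the other. *)
Hypothesis lo_inj1 : forall p q, lo p = lo q -> p.1 = q.1.

Lemma le_lo_hi p : lo p <= hi p.
Proof. by rewrite lerD2r. Qed.

Lemma lo_inj : injective lo.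
Proof.
move=> [u z] [v z'] e; have := lo_inj1 e; rewrite /= => E; subst v; move: e; rewrite /lo /=.
move=> /addrI /(mulfI (lt0r_neq0 tau_gt0)) /eqP; rewrite eqr_int => /eqP -> //.
Qed.

(** Of two overlapping lifts, the one that starts first reaches the left end of the other, so the
    walk leaves no gap between its first and last left ends. *)
Lemma walk_overlap_cover k p q : walk overlap k p q ->
  exists f : nat -> V, [/\ f 0%N = p.1, f k = q.1 &
    forall t, Num.min (lo p) (lo q) <= t <= Num.max (lo p) (lo q) ->
      exists i z, (i <= k)%N /\ lo (f i, z) <= t <= hi (f i, z)].
Proof.
elim=> {k p q} [p|k p q r [pq qp] _ [f [f0 fk h]]].
  exists (fun=> p.1); split=> // t; rewrite minxx maxxx => tp.
  exists 0%N, p.2; split=> //; change (lo p <= t <= hi p).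
  by case/andP: tp => t1 t2; rewrite t1 (le_trans t2) // le_lo_hi.
exists (fun i => if i is i'.+1 then f i' else p.1); split=> // t.
rewrite ge_min le_max => ht.
have [tq|tq] := boolP (Num.min (lo q) (lo r) <= t <= Num.max (lo q) (lo r)).
  by have [i [z [ik iz]]] := h t tq; exists i.+1, z.
have [/andP[tp1 tp2]|/andP[tp1 tp2]] : lo p <= t <= lo q \/ lo q <= t <= lo p.
  move: tq ht; rewrite ge_min le_max; do 4 case: lerP => ?; rewrite ?orbT ?orbF //=; lra.
- exists 0%N, p.2; split=> //; change (lo p <= t <= hi p).
  by rewrite tp1 (le_trans tp2).
- exists 1%N, q.2; split=> //; rewrite f0; change (lo q <= t <= hi q).
  by rewrite tp1 (le_trans tp2).
Qed.

(** The middle of a gap between consecutive lifts would be uncovered: later lifts start too late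
    and, by [hi_mono], earlier ones end too soon. *)
Lemma overlap_next (W : int -> V * int) :
  (forall i j, i < j -> lo (W i) < lo (W j)) ->
  (forall t, exists i, lo (W i) <= t <= hi (W i)) ->
  forall i, overlap (W i) (W (i + 1)).
Proof.
move=> Wlt Wcov i; split.
  by apply: le_trans (ltW (Wlt _ _ _)) (le_lo_hi _); lia.
rewrite leNgt; apply/negP => gap.
have [j /andP[j1 j2]] := Wcov ((hi (W i) + lo (W (i + 1))) / 2).
have [ij|ij] := leP (i + 1) j.
  have : lo (W (i + 1)) <= lo (W j).
    by move: ij; rewrite le_eqVlt => /orP[/eqP-> //|/Wlt/ltW].
  lra.
have : hi (W j) <= hi (W i).
  apply: hi_mono; have [->//|ne] := eqVneq j i.
  by apply/ltW/Wlt; lia.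
lra.
Qed.

Lemma floor_decomp t u : exists z, u <= t - tau * z%:~R < u + tau.
Proof.
exists (Num.floor ((t - u) / tau)); have /andP[] := floor_itv ((t - u) / tau).
move: (Num.floor _) => z; rewrite ler_pdivlMr // ltr_pdivrMr // intrD mulr1z mulrDl mul1r => h1 h2.
by apply/andP; split; lra.
Qed.

(** * Minimum covers: winding closed walks and the cyclic order *)

Section MinimalCover.
Variables (n : nat) (f0 : 'I_n -> V).
Hypothesis f0_inj : injective f0.
Hypothesis f0_cov : covers f0.
Hypothesis f0_min : forall k (f : 'I_k -> V), covers f -> (n <= k)%N.

(** The end points of the walk are at least [tau] apart, so its lifts cover a full period. The
    [k + 1] lifts belong to at most [k] arcs, since the first and the last lie over the same vertex;
    hence the family [f i.+1] without index 0. *)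
Lemma closed_walk_ge k p z : walk overlap k p (shift z p) -> z != 0 -> (n <= k)%N.
Proof.
move=> w z0; have [f [fp fk h]] := walk_overlap_cover w.
have k0 : (0 < k)%N.
  case: k w {h fk} => // w; move: z0.
  by have /(congr1 snd) /= := walk0 w; lia.
apply: (@f0_min k (fun i => f i.+1)) => t.
suff [i [c [ik ht]]] : exists i c, (i <= k)%N /\ lo (f i, c) <= t <= hi (f i, c).
  have [j jk fj] : exists2 j : 'I_k, True & f j.+1 = f i.
    case: i ik ht => [_ _|i ik _]; last by exists (Ordinal ik).
    have kk : (k.-1 < k)%N by rewrite prednK.
    by exists (Ordinal kk) => //=; rewrite prednK // fk fp.
  by exists j, c; rewrite fj.
have [c /andP[c1 c2]] := floor_decomp t (lo p).
have wrap d : (exists i z', (i <= k)%N /\ lo (f i, z') <= t - tau * d%:~R <= hi (f i, z')) ->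
    exists i z', (i <= k)%N /\ lo (f i, z') <= t <= hi (f i, z').
  move=> [i [z' [ik /andP[h1 h2]]]]; exists i, (z' + d); split=> //.
  rewrite -[(f i, _)]/(shift d (f i, z')) lo_shift hi_shift.
  by apply/andP; split; lra.
have [zp|zn] : (1 <= z)%R \/ (z <= -1)%R by lia.
  apply: (wrap c); apply: h; rewrite ge_min c1 /= le_max lo_shift; apply/orP; right.
  have : tau <= tau * z%:~R by rewrite ler_peMr ?ler1z // ltW.
  lra.
(* A walk of negative winding covers the period that ends at [lo p], one period before the one used
   for positive [z]. *)
apply: (wrap (c + 1)); apply: h; rewrite ge_min le_max lo_shift intrD mulr1z mulrDr mulr1.
have : tau * z%:~R <= - tau.
  by rewrite -[- tau]mulrN1 ler_pM2l // -[-1]/((-1)%:~R) ler_int.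
by move=> ?; apply/andP; split; apply/orP; [right | left]; lra.
Qed.

(** All lifts of the covering arcs in one increasing sequence: the remainder of the index modulo [n]
    selects the arc, sorted by left end, and the quotient its period. *)
Lemma cyclic_order : (0 < n)%N -> exists W : int -> V * int,
  [/\ forall i, W (i + n%:Z) = shift 1 (W i),
       forall i j, i < j -> lo (W i) < lo (W j) &
       forall t, exists i, lo (W i) <= t <= hi (W i)].
Proof.
move=> n0; have x0 : 'I_n by exact: Ordinal n0.
pose le_a := relpre (fun i => a (f0 i)) <=%R.
pose s := sort le_a (enum 'I_n).
have le_a_total : total le_a by move=> i j; exact: le_total.
have le_a_trans : transitive le_a by move=> i j k; exact: le_trans.
have s_size : size s = n by rewrite size_sort size_enum_ord.
have s_uniq : uniq s by rewrite sort_uniq enum_uniq.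
have s_lt i j : (i < j < n)%N -> a (f0 (nth x0 s i)) < a (f0 (nth x0 s j)).
  move=> /andP[ij jn]; rewrite lt_neqAle; apply/andP; split.
    apply/negP => /eqP e; have : lo (f0 (nth x0 s i), 0) = lo (f0 (nth x0 s j), 0).
      by rewrite /lo /= e.
    move=> /lo_inj [] /f0_inj /eqP; rewrite nth_uniq ?s_size //; lia.
  apply: (sorted_leq_nth le_a_trans) => //; last exact: ltnW.
  - by move=> k; exact: lexx.
  - exact: sort_sorted.
  - by rewrite inE s_size; lia.
  - by rewrite inE s_size.
pose W i : V * int := (f0 (nth x0 s `|(i %% n%:Z)%Z|%N), (i %/ n%:Z)%Z).
have WE z (r : nat) : (r < n)%N -> W (z * n%:Z + r%:Z) = (f0 (nth x0 s r), z).
  move=> rn; rewrite /W modzMDl divzMDl ?modz_small ?divz_small ?addr0 //; lia.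
have dec i : exists z (r : nat), (r < n)%N /\ i = z * n%:Z + r%:Z.
  exists (i %/ n%:Z)%Z, `|(i %% n%:Z)%Z|%N.
  have := divz_eq i n%:Z; have := @modz_ge0 i n%:Z; have := @ltz_pmod i n%:Z; lia.
have Wstep i : lo (W i) < lo (W (i + 1)).
  have [z [r [rn ->]]] := dec i; rewrite WE //.
  have [rn'|rn'] := ltnP r.+1 n.
    have -> : z * n%:Z + r%:Z + 1 = z * n%:Z + r.+1%:Z by lia.
    by rewrite WE // /lo /= ltrD2r; apply: s_lt; rewrite ltnSn.
  (* From the last arc of a period to the first of the next, [0 <= a < tau] gives the inequality. *)
  have -> : z * n%:Z + r%:Z + 1 = (z + 1) * n%:Z + 0%N%:Z by lia.
  rewrite WE // /lo /= intrD mulr1z mulrDr mulr1.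
  have /andP[_ ?] := a_range (f0 (nth x0 s r)).
  have /andP[? _] := a_range (f0 (nth x0 s 0)).
  lra.
exists W; split.
- move=> i; have [z [r [rn ->]]] := dec i.
  have -> : z * n%:Z + r%:Z + n%:Z = (z + 1) * n%:Z + r%:Z by lia.
  by rewrite !WE.
- move=> i j ij; have [m ->] : exists m : nat, j = i + m.+1%:Z.
    by exists (`|j - i|%N.-1); lia.
  elim: m => [|m IH]; first exact: Wstep.
  have -> : i + m.+2%:Z = i + m.+1%:Z + 1 by lia.
  exact: lt_trans IH (Wstep _).
- move=> t; have [i [z h]] := f0_cov t.
  exists (z * n%:Z + (index i s)%:Z); rewrite WE ?nth_index ?mem_sort ?mem_enum //.
  by rewrite -[X in (_ < X)%N]s_size index_mem mem_sort mem_enum.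
Qed.

End MinimalCover.

Variable G : graph V.
Hypothesis adjP : forall u v,
  adj G u v <-> u <> v /\ exists z, overlap (u, 0) (v, z).

Lemma adj_overlap u v z : adj G u v -> exists z', overlap (u, z) (v, z').
Proof.
move=> /adjP[_ [z' h]]; exists (z' + z).
by have := overlap_shift z h; rewrite /shift /= add0r.
Qed.

Lemma overlap_adj p q : overlap p q -> p.1 = q.1 \/ adj G p.1 q.1.
Proof.
move=> h; have [|n] := pselect (p.1 = q.1); [by left | right].
apply/adjP; split=> //; exists (q.2 - p.2).
by have := overlap_shift (- p.2) h; rewrite /shift /= subrr.
Qed.

(** Path lifting along the covering of the circle by the line. *)
Lemma walk_lift k u v z : walk (adj G) k u v ->
  exists z', walk overlap k (u, z) (v, z').
Proof.
move=> w; elim: w z => {k u v} [u z|k u v w uv _ IH z].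
  by exists z; exact: walk_nil.
have [z1 h1] := adj_overlap z uv; have [z2 h2] := IH z1.
by exists z2; exact: walk_cons h1 h2.
Qed.

(* An arc meeting the arc of c and not contained in it contains an endpoint
   of it, and there are only two endpoints. *)
Lemma adj_claw_free c u v w : adj G u c -> adj G v c -> adj G w c ->
  u <> v -> u <> w -> v <> w -> [\/ adj G u v, adj G u w | adj G v w].
Proof.
have ends x : adj G x c -> exists z, lo (x, z) <= lo (c, 0) <= hi (x, z) \/
                                    lo (x, z) <= hi (c, 0) <= hi (x, z).
  move=> h; have [z [h1 h2]] := adj_overlap 0 (adj_sym h); exists z.
  have [lxc|/ltW/hi_mono lcx] := leP (lo (x, z)) (lo (c, 0)).
    by left.
  by right; rewrite h2.
have meet x y z z' t : x <> y -> lo (x, z) <= t <= hi (x, z) ->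
    lo (y, z') <= t <= hi (y, z') -> adj G x y.
  move=> xy /andP[h1 h2] /andP[h3 h4].
  have : overlap (x, z) (y, z').
    by split; [apply: le_trans h1 _ | apply: le_trans h3 _].
  by move=> /overlap_adj [].
move=> /ends[zu hu] /ends[zv hv] /ends[zw hw] uv uw vw.
case: hu hv hw => hu [] hv [] hw.
all: try by (constructor 1; apply: meet hu hv).
all: try by (constructor 2; apply: meet hu hw).
all: by (constructor 3; apply: meet hv hw).
Qed.

(** * The cycle of covering arcs inside the graph *)

Section CyclicOrder.
Variables (n : nat) (W : int -> V * int).
Hypothesis n2 : (2 <= n)%N.
Hypothesis W_per : forall i, W (i + n%:Z) = shift 1 (W i).
Hypothesis W_lt : forall i j, i < j -> lo (W i) < lo (W j).
Hypothesis W_cov : forall t, exists i, lo (W i) <= t <= hi (W i).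

Local Notation c i := ((W i).1) (only parsing).

Lemma W_shift i z : W (i + z * n%:Z) = shift z (W i).
Proof.
have pos (m : nat) j : W (j + m%:Z * n%:Z) = shift m%:Z (W j).
  elim: m j => [|m IH] j; first by rewrite mul0r addr0 shift0.
  have -> : j + m.+1%:Z * n%:Z = j + m%:Z * n%:Z + n%:Z by lia.
  by rewrite W_per IH shiftD; congr shift; lia.
have [m [->|->]] : exists m : nat, z = m%:Z \/ z = - m%:Z by exists `|z|%N; lia.
  exact: pos.
have := pos m (i + - m%:Z * n%:Z); rewrite -addrA -mulrDl addNr mul0r addr0 => ->.
by rewrite shiftD subrr shift0.
Qed.

Lemma vertex_per i : c (i + n%:Z) = c i.
Proof. by rewrite W_per. Qed.

(** The two vertices differ because, for [n >= 2], [W (i + 1)] starts strictly between two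
    consecutive lifts of the same arc, [W i] and [W (i + n)]. *)
Lemma vertex_adj i : adj G (c i) (c (i + 1)).
Proof.
have [e|//] := overlap_adj (overlap_next W_lt W_cov i).
have lt1 : lo (W i) < lo (W (i + 1)) by apply: W_lt; lia.
have lt2 : lo (W (i + 1)) < lo (W (i + n%:Z)) by apply: W_lt; lia.
have E : W (i + 1) = shift ((W (i + 1)).2 - (W i).2) (W i).
  by case: (W (i + 1)) e => ? ? /= <-; rewrite /shift /= addrC subrK.
move: lt1 lt2; rewrite W_per E !lo_shift ltrDl ltrD2l.
by rewrite pmulr_rgt0 // ltr_pM2l // ltr0z ltr_int; lia.
Qed.

Lemma walk_W i j : walk overlap `|i - j|%N (W i) (W j).
Proof.
have pos (m : nat) k : walk overlap m (W k) (W (k + m%:Z)).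
  elim: m k => [|m IH] k; first by rewrite addr0; exact: walk_nil.
  apply: walk_cons (overlap_next W_lt W_cov k) _.
  by have -> : k + m.+1%:Z = k + 1 + m%:Z by lia.
have [ij|ij] := leP i j.
  by have := pos `|i - j|%N i; have -> : i + `|i - j|%N%:Z = j by lia.
apply: walk_rev; first exact: overlap_sym.
by have := pos `|i - j|%N j; have -> : j + `|i - j|%N%:Z = i by lia.
Qed.

Lemma walk_vertex i (m : nat) : walk (adj G) m (c i) (c (i + m%:Z)).
Proof.
elim: m i => [|m IH] i; first by rewrite addr0; exact: walk_nil.
apply: walk_cons (vertex_adj i) _.
by have -> : i + m.+1%:Z = i + 1 + m%:Z by lia.
Qed.

(** The lifted walk from [W i] ends at some [W (j + d * n)]. Returning along the cycle to
    [W (i + z * n)] with [z] nonzero gives a closed walk of winding [z], so [n] is at most [k] plus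
    the length of the return. *)
Lemma vertex_dist k i j :
  (forall k p z, walk overlap k p (shift z p) -> z != 0 -> (n <= k)%N) ->
  walk (adj G) k (c i) (c j) -> exists z, (`|(j - i + z * n%:Z)%R|%N <= k)%N.
Proof.
move=> closed /(@walk_lift _ _ _ (W i).2) [z' w].
pose d := z' - (W j).2.
have {w} w : walk overlap k (W i) (W (j + d * n%:Z)).
  move: w; rewrite W_shift /shift /d addrC subrK.
  by case: (W i) => ? ?.
have cl z : z != 0 -> (n <= k + `|(j + d * n%:Z - (i + z * n%:Z))%R|)%N.
  move=> z0; apply: (closed _ (W i) z) => //; rewrite -W_shift.
  exact: walk_cat w (walk_W _ _).
pose D := j + d * n%:Z - i.
have n0 : n%:Z != 0 by lia.
have [q [r [r0 rn DE]]] : exists q r : int, [/\ 0 <= r, r < n%:Z & D = q * n%:Z + r].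
  exists (D %/ n%:Z)%Z, (D %% n%:Z)%Z.
  by rewrite modz_ge0 // -divz_eq ltz_pmod //; lia.
(* Here [q] is the number of full turns of the walk: close it up with winding 1 if there are none,
   and with winding [q] otherwise. *)
have [q0|q0] := eqVneq q 0.
  by exists d; have := cl 1; rewrite q0 in DE; rewrite /D in DE; lia.
by exists (d - q - 1); have := cl q q0; rewrite /D in DE; lia.
Qed.

(** Choose [i] so that [u] starts between [W i] and [W (i + 1)]. By [hi_mono] it ends no sooner than
    [W i], which already reaches [W (i + 1)]. *)
Lemma near_cycle u : exists i, overlap (u, 0) (W i) /\ overlap (u, 0) (W (i + 1)).
Proof.
have [i [h1 h2]] : exists i, lo (W i) <= lo (u, 0) /\ lo (u, 0) < lo (W (i + 1)).
  have [z /andP[h1 h2]] := floor_decomp (lo (u, 0)) (lo (W 0)).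
  have {h1} : lo (W (0 + z * n%:Z)) <= lo (u, 0) by rewrite W_shift lo_shift; lra.
  have {h2} : lo (u, 0) < lo (W (0 + z * n%:Z + n%:Z)).
    by rewrite W_per lo_shift W_shift lo_shift mulr1z mulr1; lra.
  move: (0 + z * n%:Z) => j; elim: n j => [|m IH] j.
    by rewrite addr0 => h1 h2; have := lt_le_trans h1 h2; rewrite ltxx.
  move=> h1 h2; have [h|h] := ltP (lo (u, 0)) (lo (W (j + 1))); first by exists j.
  by apply: (IH (j + 1)) => //; have -> : j + 1 + m%:Z = j + m.+1%:Z by lia.
exists i; have [_ h3] := overlap_next W_lt W_cov i.
have := hi_mono h1; have := le_lo_hi (W (i + 1)) => h4 h5.
by split; split; lra.
Qed.

Lemma walk_touch u p : overlap (u, 0) p ->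
  exists2 k, walk (adj G) k u p.1 & (k <= 1)%N.
Proof.
move=> /overlap_adj [/= ->|h]; first by exists 0%N; [exact: walk_nil|].
by exists 1%N; [exact: walk1|].
Qed.

(** Each vertex touches two consecutive vertices of the cycle. If the two pairs differ, the gaps
    between them on the two sides have total length [n - 2]; the shorter one and two steps off the
    cycle give the bound. *)
Lemma vertex_diam u v : exists2 k, walk (adj G) k u v & (k <= n %/ 2 + 1)%N.
Proof.
have [i [u1 u2]] := near_cycle u.
have [j [v1 v2]] := near_cycle v.
have n0 : n%:Z != 0 by lia.
have [q [m [mn DE]]] : exists (q : int) (m : nat), (m < n)%N /\ j = i + m%:Z + q * n%:Z.
  exists ((j - i) %/ n%:Z)%Z, `|((j - i) %% n%:Z)%Z|%N.
  have := @modz_ge0 (j - i) n%:Z n0; have := divz_eq (j - i) n%:Z.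
  have : ((j - i) %% n%:Z)%Z < n%:Z by rewrite ltz_pmod //; lia.
  by lia.
have cj : c j = c (i + m%:Z) by rewrite DE W_shift.
have cj1 : c (j + 1) = c (i + m%:Z + 1).
  rewrite DE (_ : i + m%:Z + q * n%:Z + 1 = i + m%:Z + 1 + q * n%:Z); last by lia.
  by rewrite W_shift.
have [k1 wu1 hk1] := walk_touch u1; have [k2 wu2 hk2] := walk_touch u2.
have [l1 wv1 hl1] := walk_touch v1; have [l2 wv2 hl2] := walk_touch v2.
have sym x y : adj G x y -> adj G y x by exact: adj_sym.
case: m cj cj1 mn DE => [|m] cj cj1 mn DE.
  exists (k1 + l1)%N; last lia.
  by apply: walk_cat wu1 _; apply: walk_rev => //; move: wv1; rewrite cj addr0.
have [hm|hm] := leqP m ((n - 2) %/ 2).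
  exists (k2 + (m + l1))%N; last lia.
  apply: walk_cat wu2 (walk_cat _ (walk_rev sym wv1)); rewrite cj.
  have := walk_vertex (i + 1) m.
  by have -> : i + 1 + m%:Z = i + m.+1%:Z by lia.
exists (k1 + ((n - m - 2) + l2))%N; last lia.
apply: walk_cat wu1 (walk_cat _ (walk_rev sym wv2)); rewrite cj1.
apply: walk_rev => //; have := walk_vertex (i + m.+1%:Z + 1) (n - m - 2).
have -> : i + m.+1%:Z + 1 + (n - m - 2)%N%:Z = i + n%:Z by lia.
by rewrite vertex_per.
Qed.

Lemma vertex_universal : n = 2%N -> forall u, u = c 0 \/ adj G u (c 0).
Proof.
move=> nE u; have [i [/overlap_adj u1 /overlap_adj u2]] := near_cycle u.
have [q [e|e]] : exists q : int, i = 0 + q * n%:Z \/ i + 1 = 0 + q * n%:Z.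
  by exists ((i + 1) %/ 2)%Z; rewrite nE; have := divz_eq (i + 1) 2;
    have := @modz_ge0 (i + 1) 2 isT; have := @ltz_pmod (i + 1) 2 isT; lia.
  by move: u1; rewrite e W_shift.
by move: u2; rewrite e W_shift.
Qed.

End CyclicOrder.

End Lifts.

(** * The lower bound from an isometric cycle *)

Section IsometricCycle.
Variables (R : realType) (V : Type) (G : graph V) (w : nat -> V) (n : nat).
Hypothesis n3 : (3 <= n)%N.
Hypothesis w_adj : forall i, adj G (w i) (w i.+1).
Hypothesis w_per : forall i, w (i + n)%N = w i.
Hypothesis w_dist : forall k i j, walk (adj G) k (w i) (w j) ->
  exists z : int, (`|(j%:Z - i%:Z + z * n%:Z)%R|%N <= k)%N.

Lemma path_point_supp (s : R) : 0 <= s -> exists i : nat,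
  [/\ i%:R <= s <= i.+1%:R, path_point w s (w i) = i.+1%:R - s,
      path_point w s (w i.+1) = s - i%:R &
      forall p, path_point w s p <> 0 -> p = w i \/ p = w i.+1].
Proof.
move=> /truncn_le h; exists (Num.truncn s).
by have [e1 e2 supp] := path_point_cases w_adj h; split.
Qed.

Lemma path_point_near (s : R) p : 0 <= s -> path_point w s p <> 0 ->
  exists2 i : nat, p = w i & `|s - i%:R| = 1 - path_point w s p.
Proof.
move=> /path_point_supp [i [/andP[h1 h2] e1 e2 supp]] hp.
move: h2 e1; rewrite -natr1 => h2 e1.
have [E|E] := supp p hp; subst p.
  by exists i => //; rewrite e1 ger0_norm; lra.
by exists i.+1 => //; rewrite e2 -natr1 ler0_norm; lra.
Qed.

(** Extends [w_dist] from the vertices to all points of the cycle; [z] counts turns, so the left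
    side is a cyclic distance for the best [z]. *)
Lemma path_point_dist_ge (s t l : R) : 0 <= s -> 0 <= t ->
  chain G (path_point w s) (path_point w t) l ->
  exists z : int, `|t - s + z%:~R * n%:R| <= l.
Proof.
move=> s0 t0 hl.
have [[u [v [a _ _ [xu xv yu yv] h]]]|[p [q [k [xp yq wk h]]]]] :=
  chain_cases (path_point_realization w_adj s0) hl.
  have n_uv := adj_neq a.
  have [i [_ si si1 supi]] := path_point_supp s0.
  have [j [_ tj tj1 supj]] := path_point_supp t0.
  have same i' j' : w i' = w j' -> exists z : int, j'%:Z - i'%:Z + z * n%:Z = 0.
    move=> e; have := walk_nil (adj G) (w i'); rewrite {2}e => /w_dist [z hz].
    by exists z; move: hz; rewrite leqn0 absz_eq0 => /eqP.
  have [z [zE vE]] : exists z : int, j%:Z - i%:Z + z * n%:Z = 0 /\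
      (v = w i /\ v = w j \/ v = w i.+1 /\ v = w j.+1).
    (* The cycle never runs through an edge in both directions: [n] would divide 2. *)
    have mixed : w i = w j.+1 -> w i.+1 = w j -> False.
      move=> /same[z1 h1] /same[z2 h2].
      have E : (z1 - z2) * n%:Z = - 2 by rewrite mulrBl; lia.
      have [h3|h3] := leP 0 (z1 - z2); first by have := mulr_ge0 h3 (ler0n int n); lia.
      have : (z1 - z2 + 1) * n%:Z <= 0 by apply: mulr_le0_ge0; lia.
      by rewrite mulrDl; lia.
    have [eu|eu] := supi u xu; have [ev|ev] := supi v xv;
      have [fu|fu] := supj u yu; have [fv|fv] := supj v yv;
      try by case: n_uv; congruence.
    - have [z zE] : exists z : int, j%:Z - i%:Z + z * n%:Z = 0 by apply: same; congruence.
      by exists z; split=> //; right.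
    - by case: mixed; congruence.
    - by case: mixed; congruence.
    - have [z zE] : exists z : int, j%:Z - i%:Z + z * n%:Z = 0 by apply: same; congruence.
      by exists z; split=> //; left.
  exists z; apply: le_trans h; rewrite le_eqVlt; apply/orP; left; apply/eqP.
  have zR : z%:~R * n%:R = i%:R - j%:R :> R.
    move: zE => /(congr1 (fun m : int => m%:~R : R)).
    by rewrite rmorphD rmorphB rmorphM /= mulr0z -!pmulrn; lra.
  rewrite zR; case: vE => -[e1 e2].
    have -> : path_point w s v = i.+1%:R - s by rewrite e1.
    have -> : path_point w t v = j.+1%:R - t by rewrite e2.
    by congr `|_|; rewrite -!natr1; lra.
  have -> : path_point w s v = s - i%:R by rewrite e1.
  have -> : path_point w t v = t - j%:R by rewrite e2.
  by rewrite distrC; congr `|_|; lra.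
have [i pE hi] := path_point_near s0 xp; have [j qE hj] := path_point_near t0 yq.
move: wk; rewrite pE qE => /w_dist [z hz].
exists z; apply: le_trans h; rewrite -hi -hj.
have {}hz : `|j%:R - i%:R + z%:~R * n%:R| <= k%:R :> R.
  move: hz; rewrite -(ler_nat R) natr_absz intr_norm.
  by rewrite rmorphD rmorphB rmorphM /= -!pmulrn.
have -> : t - s + z%:~R * n%:R =
    i%:R - s + (j%:R - i%:R + z%:~R * n%:R) + (t - j%:R) by lra.
apply: le_trans (ler_normD _ _) _; rewrite lerD2r.
by apply: le_trans (ler_normD _ _) _; rewrite distrC lerD2l.
Qed.

Lemma delta_ge_cycle : ((n%:R / 4)%:E <= delta R G)%E.
Proof.
have n0 : 0 < n%:R :> R by rewrite ltr0n; lia.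
(* Seen from the midpoint of one half, the other half occupies the arc lengths from [n / 4] to
   [3 n / 4]. *)
have away (d : R) (z : int) : n%:R / 4 <= d -> d <= 3 * (n%:R / 4) ->
    Num.min d (n%:R - d) <= `|d + z%:~R * n%:R|.
  move=> d1 d2; rewrite ge_min.
  have [h|h] : (0 <= z)%R \/ (z <= -1)%R by lia.
    have : 0 <= z%:~R * n%:R :> R by rewrite mulr_ge0 ?ler0z // ltW.
    by move=> ?; apply/orP; left; rewrite ger0_norm; lra.
  have : z%:~R * n%:R <= - n%:R :> R.
    by rewrite -[- n%:R]mulN1r ler_pM2r // -[-1]/((-1)%:~R) ler_int.
  by move=> ?; apply/orP; right; rewrite ler0_norm; lra.
apply: (@delta_ge_bigon _ _ _ w n 0) => //.
  move=> l /path_point_dist_ge [||z]; [lra | lra |]; rewrite add0r subr0.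
  by have := away (n%:R / 2) z; rewrite ge_min => h ?; lra.
move=> t l t1 t2 /path_point_dist_ge [||z]; [lra | lra |]; rewrite add0r.
by have := away (t - n%:R / 4) z; rewrite ge_min => h ?; lra.
Qed.

End IsometricCycle.

(** * Arcs of the circle *)

Section Circle.
Variable R : realType.
Implicit Types (s t : R) (z : int).

Let tau : R := pi *+ 2.

Lemma tau_gt0 : 0 < tau.
Proof. by rewrite pmulrn_lgt0 // pi_gt0. Qed.

Definition circle_point t : R * R := (cos t, sin t).

Lemma circle_point_shift t z : circle_point (t + tau * z%:~R) = circle_point t.
Proof.
have pos (m : nat) r : circle_point (r + tau * m%:R) = circle_point r.
  by rewrite mulr_natr /circle_point (periodicn (@cosD2pi R)) (periodicn (@sinD2pi R)).
have [m [->|->]] : exists m : nat, z = m%:Z \/ z = - m%:Z by exists `|z|%N; lia.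
  exact: pos.
by rewrite -(pos m) rmorphN /= mulrN subrK.
Qed.

Lemma circle_pointP (p : R * R) : circle p <-> exists t, p = circle_point t.
Proof.
split; last by move=> [t ->]; exact: cos2Dsin2.
case: p => x y /= e; rewrite /circle /= in e.
have x1 : -1 <= x <= 1.
  have : x ^+ 2 <= 1 by rewrite -e lerDl sqr_ge0.
  by rewrite -ler_norml -(ler_sqr (normr_ge0 _)) ?nnegrE // ?expr1n ?real_normK ?num_real.
have sE : sin (acos x) = `|y|.
  by rewrite sin_acos // -e addrC addKr sqrtr_sqr.
have cE : cos (acos x) = x by rewrite acosK // in_itv.
have [y0|y0] := leP 0 y.
  by exists (acos x); rewrite /circle_point cE sE ger0_norm.
by exists (- acos x); rewrite /circle_point cosN sinN cE sE ltr0_norm // opprK.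
Qed.

Lemma circle_point_eq s t : circle_point s = circle_point t ->
  exists z, s = t + tau * z%:~R.
Proof.
move=> [ec es]; have c1 : cos (s - t) = 1.
  by rewrite cosB ec es -!expr2 cos2Dsin2.
have [z /andP[h1 h2]] := floor_decomp tau_gt0 (s - t) 0.
exists z; suff : s - t - tau * z%:~R = 0 by lra.
move: h1 h2; rewrite add0r; set d := s - t - _ => h1 h2.
have cd : cos d = 1.
  have := circle_point_shift (s - t) (- z); rewrite /circle_point rmorphN /= mulrN.
  by move=> [-> _].
have [dpi|dpi] := leP d pi.
  apply: (@cos_inj R); rewrite ?in_itv /= ?h1 ?lexx ?pi_ge0 //.
  by rewrite cd cos0.
have tauE : tau = pi + pi by rewrite /tau mulr2n.
(* [cos] is injective only on [[0, pi]]; beyond [pi] its evenness gives [d = tau], which is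
   excluded. *)
have E : tau - d = 0.
  apply: (@cos_inj R); rewrite ?in_itv /= ?lexx ?pi_ge0 //.
    by apply/andP; split; lra.
  rewrite cos0 -cd -[RHS]cosN.
  by have := circle_point_shift (- d) 1; rewrite mulr1z mulr1 addrC => -[].
lra.
Qed.

Lemma closed_arcP (a b : R) t : closed_arc a b (circle_point t) <->
  exists z, a + tau * z%:~R <= t <= b + tau * z%:~R.
Proof.
split.
  case=> r /=; rewrite in_itv /= => /andP[h1 h2] /esym /circle_point_eq [z ->].
  by exists z; rewrite !lerD2r h1.
case=> z /andP[h1 h2]; exists (t - tau * z%:~R).
  by rewrite /= in_itv /=; apply/andP; split; lra.
by have := circle_point_shift t (- z); rewrite rmorphN /= mulrN.
Qed.

Lemma closed_arc_sub (a b : R) p : closed_arc a b p -> exists t, p = circle_point t.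
Proof. by case=> t _ <-; exists t. Qed.

Variables (V : Type) (G : graph V) (I : V -> set (R * R)).

Lemma arc_lifts : (forall v, is_arc (I v)) -> exists a b : V -> R,
  [/\ forall v, 0 <= a v < tau, forall v, a v < b v &
      forall v t, I v (circle_point t) <->
        exists z, lo a tau (v, z) <= t <= hi b tau (v, z)].
Proof.
move=> arc.
have /choice [f hf] : forall v, exists ab : R * R, [/\ 0 <= ab.1 < tau, ab.1 < ab.2 &
    forall t, I v (circle_point t) <->
      exists z, ab.1 + tau * z%:~R <= t <= ab.2 + tau * z%:~R].
  move=> v; have [a [b [ab ->]]] := arc v.
  have [c hc] := floor_decomp tau_gt0 a 0.
  exists (a - tau * c%:~R, b - tau * c%:~R); split=> /=; [by rewrite add0r in hc| lra|].
  move=> t; rewrite closed_arcP; split=> -[z hz].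
    by exists (z + c); rewrite rmorphD /= mulrDr; move: hz => /andP[? ?]; apply/andP; split; lra.
  by exists (z - c); rewrite rmorphB /= mulrBr; move: hz => /andP[? ?]; apply/andP; split; lra.
by exists (fun v => (f v).1), (fun v => (f v).2); split=> v; have [] := hf v.
Qed.

Hypothesis proper : proper_arc_representation G I.

Lemma proper_lifts : exists a b : V -> R,
  [/\ forall v, 0 <= a v < tau, forall v, a v <= b v,
      forall p q, lo a tau p <= lo a tau q -> hi b tau p <= hi b tau q,
      forall p q, lo a tau p = lo a tau q -> p.1 = q.1 &
      forall u v, adj G u v <-> u <> v /\ exists z, overlap a b tau (u, 0) (v, z)] /\
  (forall v t, I v (circle_point t) <->
     exists z, lo a tau (v, z) <= t <= hi b tau (v, z)).
Proof.
have [[arc adjI] prop] := proper.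
have [a [b [ar ab mem]]] := arc_lifts arc.
(* Nested lifts project to nested arcs, which properness allows only for a single vertex. *)
have sub p q : lo a tau p <= lo a tau q -> hi b tau q <= hi b tau p -> p.1 = q.1.
  move=> h1 h2; have [//|n] := pselect (p.1 = q.1).
  case: (prop _ _ (nesym n)) => x Ix.
  have [t tE] : exists t, x = circle_point t.
    have [c [d [_ cd]]] := arc q.1; apply: (@closed_arc_sub c d).
    by rewrite -cd.
  move: Ix; rewrite tE => /mem [z /andP[z1 z2]]; apply/mem; exists (z - q.2 + p.2).
  have l1 := lo_shift a tau (z - q.2) p; have l2 := hi_shift b tau (z - q.2) p.
  have l3 := lo_shift a tau (z - q.2) q; have l4 := hi_shift b tau (z - q.2) q.
  rewrite /shift addrC subrK in l3 l4; rewrite /shift addrC in l1 l2.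
  by rewrite l1 l2; apply/andP; split; lra.
exists a, b; split=> //; split=> //.
- by move=> v; exact: ltW.
- move=> p q h; rewrite leNgt; apply/negP => h'.
  have e := sub p q h (ltW h'); move: h h'; rewrite /lo /hi e lerD2l ltrD2l.
  by move=> h; rewrite ltNge h.
- move=> p q h; have [hi_le|hi_lt] := leP (hi b tau q) (hi b tau p).
    by apply: sub; rewrite ?h.
  by symmetry; apply: sub; rewrite ?h // ltW.
- move=> u v; rewrite adjI; split=> -[n h]; split=> //.
    case: h => x [Iu]; have [t tE] : exists t, x = circle_point t.
      have [c [d [_ cd]]] := arc u; apply: (@closed_arc_sub c d).
      by rewrite -cd.
    move: Iu; rewrite tE => /mem [z /andP[z1 z2]] /mem [z' /andP[z3 z4]].
    exists (z' - z).
    have := @overlap_shift _ _ a b tau (- z) (u, z) (v, z').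
    rewrite /shift /= subrr; apply; split; [exact: le_trans z1 z4 | exact: le_trans z3 z2].
  case: h => z [h1 h2].
  have lh p : lo a tau p <= hi b tau p by rewrite lerD2r ltW.
  (* The later of the two left ends belongs to both lifts. *)
  exists (circle_point (Num.max (lo a tau (u, 0)) (lo a tau (v, z)))).
  split; apply/mem; [exists 0 | exists z]; rewrite le_max ge_max lexx ?orbT /=.
    by rewrite lh.
  by rewrite h1 lh.
Qed.

End Circle.

(** * Total sets as finite families of arcs *)

Section Rho.
Variables (R : realType) (V : Type) (I : V -> set (R * R)).

(** A nonzero value is not the default of [xget], hence it is the true minimum. *)
Lemma rhoP : rho I != 0%N ->
  total_size I (rho I) /\ forall m, total_size I m -> (rho I <= m)%N.
Proof. by rewrite /rho; case: xgetP => // n -> []. Qed.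

Lemma rho_eq n : total_size I n -> (forall m, total_size I m -> (n <= m)%N) -> rho I = n.
Proof.
move=> h1 h2; apply: xget_unique => // m [m1 m2].
by apply/eqP; rewrite eqn_leq m2 ?h2.
Qed.

Lemma total_family n : total_size I n -> exists f : 'I_n -> V,
  injective f /\ \bigcup_(i in [set: 'I_n]) I (f i) = @circle R.
Proof.
case=> K [/card_set_bijP [g [gI g_inj g_surj]] tot].
have /choice [f hf] : forall i : 'I_n, exists v, K v /\ g v = i.
  by move=> i; have [v Kv e] := g_surj i (ltn_ord i); exists v.
exists f; split.
  by move=> i j e; apply: val_inj => /=; rewrite -(hf i).2 -(hf j).2 e.
rewrite -tot; apply/seteqP; split=> x [].
  by move=> i _ Ix; exists (f i) => //; exact: (hf i).1.
move=> v Kv Ix; exists (Ordinal (gI _ Kv : (g v < n)%N)) => //.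
suff -> : f (Ordinal (gI _ Kv : (g v < n)%N)) = v by [].
by apply: g_inj; [apply: mem_set; case: (hf (Ordinal (gI v Kv : (g v < n)%N))) |
  exact: mem_set | rewrite (hf _).2].
Qed.

(** A family may repeat vertices, so its image can have fewer than [k] elements. *)
Lemma family_total k (f : 'I_k -> V) :
  \bigcup_(i in [set: 'I_k]) I (f i) = @circle R ->
  exists2 m, total_size I m & (m <= k)%N.
Proof.
move=> tot; have k0 : (0 < k)%N.
  have : @circle R (circle_point 0) by apply/circle_pointP; exists 0.
  by rewrite -tot => -[i _ _]; case: k i {f tot} => // -[].
pose g i := f (insubd (Ordinal k0) i).
pose K := g @` `I_k.
have Kk : (K #<= `I_k)%card by exact: card_image_le.
have [m Km] : exists m, (K #= `I_m)%card.
  by apply/finite_setP/finite_set_leP; exists k.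
exists m; last first.
  rewrite -card_le_II; apply: card_le_trans Kk.
  by move: Km; rewrite card_eq_le => /andP[].
exists K; split=> //; rewrite /Defs.is_total -tot; apply/seteqP; split=> x [].
  by move=> v [i ik <-] Ix; exists (insubd (Ordinal k0) i).
move=> i _ Ix; exists (f i) => //; exists i; first exact: ltn_ord.
by rewrite /g valKd.
Qed.

End Rho.

(** * The bounds for each value of [rho] *)

Section ProperBounds.
Variables (R : realType) (V : Type) (G : graph V) (I : V -> set (R * R)).
Hypothesis proper : proper_arc_representation G I.

Local Notation n := (rho I).

(** For [n >= 2] the bounds on [delta] use the arcs only through these four facts. *)
Lemma rho_cyclic_order : (2 <= n)%N ->
  [/\ forall u v, exists2 k, walk (adj G) k u v & (k <= n %/ 2 + 1)%N,
      (3 <= n)%N -> ((n%:R / 4)%:E <= delta R G)%E,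
      n = 2%N -> exists c, forall u, u = c \/ adj G u c &
      forall c u v w, adj G u c -> adj G v c -> adj G w c ->
        u <> v -> u <> w -> v <> w -> [\/ adj G u v, adj G u w | adj G v w]].
Proof.
move=> n2; have n0 : n != 0%N by lia.
have [tot_n n_min] := rhoP n0.
have [a [b [[ar ab mono inj adjP] mem]]] := proper_lifts proper.
have [f [f_inj f_tot]] := total_family tot_n.
have coverE k (g : 'I_k -> V) : covers a b (pi *+ 2) g <->
    \bigcup_(i in [set: 'I_k]) I (g i) = @circle R.
  split=> [cov|tot t].
    apply/seteqP; split=> x.
      move=> [i _]; have [c [d [_ ->]]] := proper.1.1 (g i).
      by case=> t _ <-; apply/circle_pointP; exists t.
    move=> /circle_pointP [t ->]; have [i [z h]] := cov t.
    by exists i => //; apply/mem; exists z.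
  have : @circle R (circle_point t) by apply/circle_pointP; exists t.
  by rewrite -tot => -[i _ /mem [z h]]; exists i, z.
have f_cov : covers a b (pi *+ 2) f by apply/coverE.
have f_min k (g : 'I_k -> V) : covers a b (pi *+ 2) g -> (n <= k)%N.
  move=> /coverE /family_total [m /n_min]; exact: leq_trans.
have tau0 := @tau_gt0 R.
have [W [W_per W_lt W_cov]] := cyclic_order tau0 ar inj f_inj f_cov (ltnW n2).
have closed := closed_walk_ge tau0 ab f_min.
split.
- by move=> u v; apply: (vertex_diam tau0 ab mono adjP n2 W_per W_lt W_cov).
- move=> n3; apply: (@delta_ge_cycle _ _ _ (fun i : nat => (W i%:Z).1) n n3).
  + move=> i; have := vertex_adj tau0 ab mono adjP n2 W_per W_lt W_cov i%:Z.
    by rewrite (_ : i%:Z + 1 = i.+1%:Z) //; lia.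
  + by move=> i; rewrite PoszD W_per.
  + move=> k i j.
    exact: (vertex_dist tau0 ab mono adjP n2 W_per W_lt W_cov (fun k p z => @closed k p z)).
- move=> e2; exists (W 0).1.
  exact: (vertex_universal tau0 ab mono adjP n2 W_per W_lt W_cov e2).
- by move=> c u v w; exact: (adj_claw_free mono adjP).
Qed.

(** An arc that is the whole circle contains every other arc, so by properness the graph is a single
    vertex. *)
Lemma delta_rho1 : n = 1%N -> delta R G = 0%:E.
Proof.
move=> n1; have [|tot _] := @rhoP _ _ I; first by rewrite n1.
rewrite n1 in tot; have [f [_ f_tot]] := total_family tot.
have [[arc adjI] prop] := proper.
have one u : u = f ord0.
  have [//|ne] := pselect (u = f ord0); case: (prop _ _ ne) => x Ix.
  have : @circle R x.
    have [c [d [_ cd]]] := arc u; move: Ix; rewrite cd => -[t _ <-].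
    by apply/circle_pointP; exists t.
  by rewrite -f_tot => -[i _]; rewrite (ord1 i).
apply/eqP; rewrite eq_le (delta_ge0 R G (f ord0)) andbT.
have := @delta_le_diam R V G 0; rewrite mul0r; apply.
have rE x : realization G x -> x = vertex_point R (f ord0).
  case=> [[v ->]|[u [v [uv _]]]]; first by rewrite (one v).
  by case: (adj_neq uv); rewrite (one u) (one v).
by move=> x y /rE -> /rE ->; exact: reach_refl.
Qed.

Lemma delta_rho2 : n = 2%N -> (0%:E <= delta R G)%E /\ (delta R G <= (5 / 4)%:E)%E.
Proof.
move=> n2; have [|diam _ univ claw] := rho_cyclic_order; first by rewrite n2.
have [c uc] := univ n2; split; first exact: delta_ge0 c.
apply: delta_le_54; first by move=> u v; have := diam u v; rewrite n2.
move=> u v w uv uw vw nuv nuw nvw.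
(* A vertex with a non-neighbour is not the universal vertex [c], so three independent vertices
   would be three independent neighbours of [c]. *)
have adjc x y : x <> y -> ~ adj G x y -> adj G x c.
  move=> xy nxy; have [e|//] := uc x; subst x.
  by have [e|h] := uc y; [case: xy | case: nxy; exact: adj_sym].
by have [] := claw c u v w (adjc _ _ uv nuv) (adjc _ _ (nesym uv) (fun h => nuv (adj_sym h)))
  (adjc _ _ (nesym uw) (fun h => nuw (adj_sym h))) uv uw vw.
Qed.

Lemma delta_rho3 : (3 <= n)%N ->
  ((n%:R / 4)%:E <= delta R G)%E /\ (delta R G <= ((n %/ 2)%:R / 2 + 1)%:E)%E.
Proof.
move=> n3; have [|diam low _ _] := rho_cyclic_order; first exact: ltnW.
split; first exact: low.
rewrite (_ : (n %/ 2)%:R / 2 + 1 = ((n %/ 2 + 1)%N%:R + 1) / 2 :> R).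
  by apply: delta_le_diam => x y; exact: realization_diam.
by rewrite natrD; lra.
Qed.

End ProperBounds.

(** * Extremal graphs *)

Section SmallGraphs.
Variables (R : realType) (V : Type) (G : graph V).
Implicit Types (x y : V -> R) (u v p q : V).

Local Notation edge := (@closed_edge R V).

(** For points in no common open edge, a lower bound reduces to the pairs formed by an end of each
    edge. *)
Lemma chain_ge_supp x y (r l : R) : realization G x ->
  (forall u v, u <> v -> x u <> 0 -> x v <> 0 -> y u <> 0 -> y v <> 0 -> False) ->
  (forall p q k, x p <> 0 -> y q <> 0 -> walk (adj G) k p q ->
     r <= 1 - x p + k%:R + (1 - y q)) ->
  chain G x y l -> r <= l.
Proof.
move=> rx ns hv /(chain_cases rx) [[u [v [a _ _ [xu xv yu yv] _]]]|].
  by case: (ns u v (adj_neq a)).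
by move=> [p [q [k [xp yq w]]]]; apply: le_trans; exact: hv.
Qed.

Lemma walk_ge1R k u v : u <> v -> walk (adj G) k u v -> 1 <= k%:R :> R.
Proof. by move=> n /(walk_ge1 n); rewrite -(ler_nat R). Qed.

Lemma walk_ge2R k u v : u <> v -> ~ adj G u v -> walk (adj G) k u v -> 2 <= k%:R :> R.
Proof. by move=> n a /(walk_ge2 n a); rewrite -(ler_nat R). Qed.

Section Cycles.
Variable w : nat -> V.
Hypothesis w_adj : forall i, adj G (w i) (w i.+1).

(** The bigon joins [w 0] to the midpoint of the opposite edge. The two missing chords at [w 0] put
    these ends at distance 5/2; the point at 5/4, a quarter past [w 1], is far from the other half
    merely because the vertices are distinct. *)
Lemma delta_ge_pentagon : (forall i, w (i + 5)%N = w i) ->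
  (forall i j, (i < j < 5)%N -> w i <> w j) ->
  ~ adj G (w 0%N) (w 2%N) -> ~ adj G (w 0%N) (w 3%N) -> ((5 / 4)%:E <= delta R G)%E.
Proof.
move=> per inj n02 n03.
have d i j : (i < j < 5)%N -> w i <> w j by exact: inj.
apply: (@delta_ge_bigon _ _ _ w 5 0) => //.
  move=> l; rewrite add0r.
  have h0 : 0%:R <= (0 : R) <= 1%:R by apply/andP; split; lra.
  have h2 : 2%:R <= (5%:R / 2 : R) <= 3%:R by apply/andP; split; lra.
  have [a1 a2 sa] := path_point_cases w_adj h0; have [b1 b2 sb] := path_point_cases w_adj h2.
  have s0 p : path_point w 0 p <> (0 : R) -> p = w 0%N.
    by move=> hp; have [//|e] := sa p hp; case: hp; rewrite e a2; lra.
  apply: chain_ge_supp.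
  - exact: path_point_realization.
  - by move=> u v uv /s0 eu /s0 ev; case: uv; rewrite eu ev.
  - move=> p q k /s0 -> /sb [] -> wk; rewrite a1 ?b1 ?b2.
      by have := walk_ge2R (d 0%N 2%N isT) n02 wk; lra.
    by have := walk_ge2R (d 0%N 3%N isT) n03 wk; lra.
move=> t l t1 t2; rewrite add0r.
have h1 : 1%:R <= (5%:R / 4 : R) <= 2%:R by apply/andP; split; lra.
have [a1 a2 sa] := path_point_cases w_adj h1.
have r1 : realization G (path_point w (5%:R / 4 : R)) by apply: path_point_realization => //; lra.
have [t3|t3] := leP t 3%:R; last have [t4|t4] := leP t 4%:R.
- have h : 2%:R <= t <= 3%:R by apply/andP; split; lra.
  have [b1 b2 sb] := path_point_cases w_adj h.
  apply: chain_ge_supp => //.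
    move=> u v uv /sa [] eu /sa [] ev /sb [] fu /sb [] fv; subst;
      try by case: uv.
    all: try by case: (d 1%N 2%N isT).
    all: try by case: (d 1%N 3%N isT).
    all: try by case: (d 2%N 3%N isT).
  move=> p q k /sa [] -> /sb [] -> wk; rewrite ?a1 ?a2 ?b1 ?b2.
  + by have := walk_ge1R (d 1%N 2%N isT) wk; lra.
  + by have := walk_ge1R (d 1%N 3%N isT) wk; lra.
  + by have := ler0n R k; lra.
  + by have := walk_ge1R (d 2%N 3%N isT) wk; lra.
- have h : 3%:R <= t <= 4%:R by apply/andP; split; lra.
  have [b1 b2 sb] := path_point_cases w_adj h.
  apply: chain_ge_supp => //.
    move=> u v uv /sa [] eu _ /sb [] fu _; subst.
    all: try by case: (d 1%N 3%N isT).
    all: try by case: (d 2%N 3%N isT).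
    all: try by case: (d 1%N 4%N isT).
    all: try by case: (d 2%N 4%N isT).
  move=> p q k /sa [] -> /sb [] -> wk; rewrite ?a1 ?a2 ?b1 ?b2.
  + by have := walk_ge1R (d 1%N 3%N isT) wk; lra.
  + by have := walk_ge1R (d 1%N 4%N isT) wk; lra.
  + by have := walk_ge1R (d 2%N 3%N isT) wk; lra.
  + by have := walk_ge1R (d 2%N 4%N isT) wk; lra.
- have h : 4%:R <= t <= 5%:R by apply/andP; split; lra.
  have [b1 b2 sb] := path_point_cases w_adj h.
  have e5 : w 5%N = w 0%N := per 0%N; rewrite e5 in b2 sb.
  apply: chain_ge_supp => //.
    move=> u v uv /sa [] eu _ /sb [] fu _; subst.
    all: try by case: (d 1%N 4%N isT).
    all: try by case: (d 2%N 4%N isT).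
    all: try by case: (d 0%N 1%N isT).
    all: try by case: (d 0%N 2%N isT).
  move=> p q k /sa [] -> /sb [] -> wk; rewrite ?a1 ?a2 ?b1 ?b2.
  + by have := walk_ge1R (d 1%N 4%N isT) wk; lra.
  + by have := walk_ge1R (nesym (d 0%N 1%N isT)) wk; lra.
  + by have := walk_ge1R (d 2%N 4%N isT) wk; lra.
  + by have := walk_ge1R (nesym (d 0%N 2%N isT)) wk; lra.
Qed.

(** Opposite vertices of an induced hexagon may be at distance 2, but midpoints of opposite edges
    are at distance 1/2 + 2 + 1/2 = 3. So the bigon starts at arc length 1/2, and the point tested
    is the vertex [w 2]. *)
Lemma delta_ge_hexagon : (forall i, w (i + 6)%N = w i) ->
  (forall i j, (i < j < 6)%N -> w i <> w j) ->
  (forall i j, (i.+1 < j < 6)%N -> (j < i + 5)%N -> ~ adj G (w i) (w j)) ->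
  ((3 / 2)%:E <= delta R G)%E.
Proof.
move=> per inj nadj.
have far i j k : (i.+1 < j < 6)%N -> (j < i + 5)%N -> walk (adj G) k (w i) (w j) ->
    2 <= k%:R :> R.
  by move=> ij ji; apply: walk_ge2R; [apply: inj; lia | exact: nadj].
have far' i j k : (i.+1 < j < 6)%N -> (j < i + 5)%N -> walk (adj G) k (w j) (w i) ->
    2 <= k%:R :> R.
  by move=> ij ji /(walk_rev (@adj_sym _ G)); exact: far.
have e6 : w 6%N = w 0%N := per 0%N.
have e7 : w 7%N = w 1%N := per 1%N.
apply: (@delta_ge_bigon _ _ _ w 6 (1 / 2)) => //.
  move=> l; have -> : 1 / 2 + 6%:R / 2 = 7 / 2 :> R by lra.
  have h0 : 0%:R <= (1 / 2 : R) <= 1%:R by apply/andP; split; lra.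
  have h3 : 3%:R <= (7 / 2 : R) <= 4%:R by apply/andP; split; lra.
  have [a1 a2 sa] := path_point_cases w_adj h0; have [b1 b2 sb] := path_point_cases w_adj h3.
  apply: chain_ge_supp.
  - by apply: path_point_realization => //; lra.
  - move=> u v uv /sa [] eu _ /sb [] fu _; subst.
    all: try by case: (inj 0%N 3%N isT).
    all: try by case: (inj 0%N 4%N isT).
    all: try by case: (inj 1%N 3%N isT).
    all: try by case: (inj 1%N 4%N isT).
  - move=> p q k /sa [] -> /sb [] -> wk; rewrite ?a1 ?a2 ?b1 ?b2.
    + by have := far 0%N 3%N k isT isT wk; lra.
    + by have := far 0%N 4%N k isT isT wk; lra.
    + by have := far 1%N 3%N k isT isT wk; lra.
    + by have := far 1%N 4%N k isT isT wk; lra.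
move=> t l t1 t2; have -> : 1 / 2 + 6%:R / 4 = 2%:R :> R by lra.
have r2 : realization G (path_point w (2%:R : R)) by exact: path_point_realization.
have a2 : path_point w (2%:R : R) (w 2%N) = 1 by rewrite path_point_nat // vertex_point_id.
have sa p : path_point w 2%:R p <> (0 : R) -> p = w 2%N.
  rewrite path_point_nat // => hp; have [//|n] := pselect (p = w 2%N).
  by rewrite vertex_point_neq in hp.
have main i : i%:R <= t <= i.+1%:R ->
    (forall k, walk (adj G) k (w 2%N) (w i) -> 3 / 2 <= k%:R + (t - i%:R)) ->
    (forall k, walk (adj G) k (w 2%N) (w i.+1) -> 3 / 2 <= k%:R + (i.+1%:R - t)) ->
    chain G (path_point w 2%:R) (path_point w t) l -> 3 / 2 <= l.
  move=> h hi hi1; have [b1 b2 sb] := path_point_cases w_adj h.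
  apply: chain_ge_supp => //.
    by move=> u v uv /sa eu /sa ev; case: uv; rewrite eu ev.
  move=> p q k /sa -> /sb [] -> wk; rewrite a2 ?b1 ?b2.
    by have := hi _ wk; rewrite -natr1; lra.
  by have := hi1 _ wk; rewrite -natr1; lra.
have [t4|t4] := leP t 4%:R; last have [t5|t5] := leP t 5%:R;
  last have [t6|t6] := leP t 6%:R.
- apply: (main 3%N); first by apply/andP; split; lra.
    by move=> k /(walk_ge1R (inj 2%N 3%N isT)); lra.
  by move=> k /(far 2%N 4%N _ isT isT); lra.
- apply: (main 4%N); first by apply/andP; split; lra.
    by move=> k /(far 2%N 4%N _ isT isT); lra.
  by move=> k /(far 2%N 5%N _ isT isT); lra.
- apply: (main 5%N); first by apply/andP; split; lra.
    by move=> k /(far 2%N 5%N _ isT isT); lra.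
  by rewrite e6 => k /(far' 0%N 2%N _ isT isT); lra.
- apply: (main 6%N); first by apply/andP; split; lra.
    by rewrite e6 => k /(far' 0%N 2%N _ isT isT); lra.
  by rewrite e7 => k /(walk_ge1R (nesym (inj 1%N 2%N isT))); lra.
Qed.

End Cycles.

Lemma triangle_diam (v0 v1 : V) : v0 <> v1 -> (forall u v, u <> v -> adj G u v) ->
  (forall a b c d : V, a <> b -> c <> d -> [\/ a = c, a = d, b = c | b = d]) ->
  forall x y, realization G x -> realization G y -> reach G x y (3 / 2).
Proof.
move=> n01 cpl meet.
have edgeP x : realization G x -> exists u v, u <> v /\ edge u v x.
  case=> [[v ->]|[u [v [uv e]]]]; last by exists u, v; split=> //; exact: adj_neq uv.
  have [e|n] := pselect (v = v0); last by exists v, v0; split=> //; exact: closed_edgel.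
  by exists v, v1; rewrite e; split=> //; exact: closed_edgel.
have shared c a b x y : c <> a -> c <> b -> edge c a x -> edge c b y ->
    reach G x y (3 / 2).
  move=> ca cb ex ey.
  have [? ? hx _] := closed_edgeP ca ex; have [? ? hy _] := closed_edgeP cb ey.
  have [e|ab] := pselect (a = b).
    subst b; apply: reach_le (reach_edge (cpl _ _ ca) ex ey) _.
    by rewrite ler_norml; apply/andP; split; lra.
  (* The routes through [c] and through [a], [b] have total length 3, so one of them is at most
     3/2. *)
  have [h|h] := leP (1 / 2) (x c + y c).
    have := reach_via (reach_endpoint (cpl _ _ ca) ex) (reach_endpoint (cpl _ _ cb) ey)
      (walk_nil _ _).
    by move=> hr; apply: reach_le hr _; lra.
  have := reach_via (reach_endpoint (cpl _ _ (nesym ca)) (closed_edge_sym ex))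
    (reach_endpoint (cpl _ _ (nesym cb)) (closed_edge_sym ey)) (walk1 (cpl _ _ ab)).
  by move=> hr; apply: reach_le hr _; lra.
move=> x y /edgeP [a [b [ab ex]]] /edgeP [c [d [cd ey]]].
have [e|e|e|e] := meet a b c d ab cd; subst.
- exact: shared ab cd ex ey.
- exact: shared ab (nesym cd) ex (closed_edge_sym ey).
- exact: shared (nesym ab) cd (closed_edge_sym ex) ey.
- exact: shared (nesym ab) (nesym cd) (closed_edge_sym ex) (closed_edge_sym ey).
Qed.

Lemma norm_betweenP (r s t : R) :
  `|r - s| + `|s - t| = `|r - t| <-> r <= s <= t \/ t <= s <= r.
Proof.
split=> [h|].
  have [rs|sr] := leP r s; have [st|ts] := leP s t;
    [by left | | | by right; apply/andP; split; exact: ltW].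
    move: h; rewrite (ler0_norm (_ : r - s <= 0)) ?(ger0_norm (_ : 0 <= s - t)); try lra.
    by case: ler0P => ? ?; [left | right]; apply/andP; split; lra.
  move: h; rewrite (ger0_norm (_ : 0 <= r - s)) ?(ler0_norm (_ : s - t <= 0)); try lra.
  by case: ler0P => ? ?; [left | right]; apply/andP; split; lra.
case=> /andP[h1 h2].
  by rewrite !ler0_norm; lra.
by rewrite !ger0_norm; lra.
Qed.

(** The coordinate at [v] is an isometry onto [[0, 1]], where a point between [x] and [y] is also
    between [y] and [z] or between [z] and [x]. *)
Lemma delta_segment u v : adj G u v -> (forall w, w = u \/ w = v) ->
  (delta R G <= 0%:E)%E.
Proof.
move=> uv two; have nuv := adj_neq uv.
have inE x : realization G x -> edge u v x.
  case=> [[w ->]|[a [b [ab e]]]].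
    by have [->|->] := two w; [exact: closed_edgel | exact: closed_edger].
  have [ea|ea] := two a; have [eb|eb] := two b; subst => //.
  - by case: (adj_neq ab).
  - exact: closed_edge_sym.
  - by case: (adj_neq ab).
have dE x y d : realization G x -> realization G y -> dist G x y = d%:E ->
    d = `|x v - y v|.
  move=> rx ry h; apply/eqP; rewrite eq_le (dist_coord v h) andbT.
  exact: dist_eq_reach h (reach_edge uv (inE _ rx) (inE _ ry)).
have hit x y (p : V -> R) S : geodesic_side G x y S -> realization G p ->
    `|x v - p v| + `|p v - y v| = `|x v - y v| ->
    exists2 q, S q & (dist G p q <= 0%:E)%E.
  move=> [L [g [gg ->]]] rp h; have [rx ry L0 dxy] := geodesic_ends gg.
  pose r := `|x v - p v|; have hL := dE _ _ _ rx ry dxy.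
  have hr : 0 <= r <= L by rewrite normr_ge0 hL -h lerDl normr_ge0.
  have [rq d1 d2] := geodesic_dist gg hr.
  have e1 := dE _ _ _ rx rq d1; have e2 := dE _ _ _ rq ry d2.
  exists (g r); first by exists r => //=; rewrite in_itv.
  apply: dist_reach; apply: reach_le (reach_edge uv (inE _ rp) (inE _ rq)) _.
  suff -> : p v = g r v by rewrite subrr normr0.
  have h' : `|x v - g r v| + `|g r v - y v| = `|x v - y v|.
    by rewrite -e1 -e2 hL addrCA subrr addr0.
  move: e1 h'; move: (g r v) => c; rewrite /r => e1 /norm_betweenP h'.
  move: e1; move/norm_betweenP: h; move: h'.
  by move=> [|] /andP[? ?] [|] /andP[? ?]; do 2 case: ler0P => ?; lra.
apply: delta_le => x y z S1 S2 S3 [L [g [gg ->]]] h2 h3 _ [s /= sL <-].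
rewrite mem_itv0 in sL.
have [rx ry L0 dxy] := geodesic_ends gg; have [rs ds1 ds2] := geodesic_dist gg sL.
have bxy : `|x v - g s v| + `|g s v - y v| = `|x v - y v|.
  rewrite -(dE _ _ _ rx rs ds1) -(dE _ _ _ rs ry ds2) -(dE _ _ _ rx ry dxy).
  by rewrite addrCA subrr addr0.
have [b|b] : `|y v - g s v| + `|g s v - z v| = `|y v - z v| \/
    `|z v - g s v| + `|g s v - x v| = `|z v - x v|.
  move/norm_betweenP: bxy => [|] /andP[h h'].
    have [k|k] := leP (z v) (g s v).
      by left; apply/norm_betweenP; right; rewrite k.
    by right; apply/norm_betweenP; right; rewrite h ltW.
  have [k|k] := leP (z v) (g s v).
    by right; apply/norm_betweenP; left; rewrite k.
  by left; apply/norm_betweenP; left; rewrite h ltW.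
- by have [q Sq dq] := hit _ _ _ _ h2 rs b; exists q => //; left.
- by have [q Sq dq] := hit _ _ _ _ h3 rs b; exists q => //; right.
Qed.

End SmallGraphs.

(** * Arcs with integer ends, decided by computation *)

Section IntegerArcs.
Variables (R : realType) (N : nat) (P L : seq nat).

Local Notation start i := (nth 0%N P i).
Local Notation len i := (nth 0%N L i).
Local Notation V := 'I_(size P).

Definition int_point (x : R) : R * R := circle_point (pi *+ 2 * (x / N%:R)).

(* The circle is cut into N equal parts; the arc of i goes from the division
   point [start i] to [start i + len i]. *)
Definition int_arc (v : V) : set (R * R) :=
  closed_arc (pi *+ 2 * ((start v)%:R / N%:R)) (pi *+ 2 * ((start v + len v)%:R / N%:R)).

Definition int_adj (u v : V) := u <> v /\ int_arc u `&` int_arc v !=set0.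

Lemma int_adj_sym u v : int_adj u v -> int_adj v u.
Proof. by move=> [n h]; split; [exact: nesym | rewrite setIC]. Qed.

Lemma int_adj_irrefl v : ~ int_adj v v.
Proof. by case. Qed.

Definition int_graph : graph V := Graph int_adj_sym int_adj_irrefl.

Definition in_arc i (s : int) : bool := ((s - (start i)%:Z) %% N%:Z)%Z <= (len i)%:Z.

(** Testing division points is enough: when two such arcs meet, they share one of their left
    ends. *)
Definition arcs_meet i j := has (fun t : nat => in_arc i t && in_arc j t) (iota 0 N).

Hypothesis N0 : (0 < N)%N.

Lemma NR0 : 0 < N%:R :> R. Proof. by rewrite ltr0n. Qed.

Lemma int_arcP v x : int_arc v (int_point x) <-> exists z : int,
  ((start v)%:Z + N%:Z * z)%:~R <= x <= ((start v)%:Z + (len v)%:Z + N%:Z * z)%:~R.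
Proof.
rewrite /int_arc /int_point closed_arcP.
have E (m : nat) (z : int) : pi *+ 2 * (m%:R / N%:R) + pi *+ 2 * z%:~R =
    pi *+ 2 * ((m%:Z + N%:Z * z)%:~R / N%:R) :> R.
  rewrite -mulrDr; congr (_ * _); rewrite rmorphD rmorphM /= -!pmulrn mulrDl.
  by rewrite [N%:R * _]mulrC mulfK // gt_eqF // NR0.
split=> -[z hz]; exists z; move: hz; rewrite !E -PoszD !ler_pM2l ?tau_gt0 //;
  by rewrite !ler_pM2r ?invr_gt0 ?NR0.
Qed.

Lemma in_arcP i s : in_arc i s <-> exists z : int,
  ((start i)%:Z + N%:Z * z <= s) && (s <= (start i)%:Z + (len i)%:Z + N%:Z * z).
Proof.
have n0 : N%:Z != 0 by lia.
rewrite /in_arc; split=> [h|[z /andP[h1 h2]]].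
  exists ((s - (start i)%:Z) %/ N%:Z)%Z.
  have := divz_eq (s - (start i)%:Z) N%:Z; have := modz_ge0 (s - (start i)%:Z) n0.
  lia.
have -> : s - (start i)%:Z = z * N%:Z + (s - (start i)%:Z - z * N%:Z) by lia.
rewrite modzMDl; set d := s - _ - _.
have d0 : 0 <= d by rewrite /d; lia.
have dl : d <= (len i)%:Z by rewrite /d; lia.
apply: le_trans dl; rewrite {2}(divz_eq d N%:Z) lerDr mulr_ge0 //.
by rewrite divz_ge0 //; lia.
Qed.

Lemma int_arc_int v (s : int) : int_arc v (int_point s%:~R) <-> in_arc v s.
Proof.
rewrite int_arcP in_arcP; split=> -[z h]; exists z; move: h; by rewrite !ler_int.
Qed.

Lemma in_arc_mod i s : in_arc i (s %% N%:Z)%Z = in_arc i s.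
Proof. by rewrite /in_arc modzDml. Qed.

Lemma mod_nat (s : int) : exists2 t : nat, t \in iota 0 N & (s %% N%:Z)%Z = t%:Z.
Proof.
have n0 : N%:Z != 0 by lia.
exists `|(s %% N%:Z)%Z|%N; last by have := modz_ge0 s n0; lia.
rewrite mem_iota /=; have := modz_ge0 s n0.
have : (s %% N%:Z)%Z < N%:Z by rewrite ltz_pmod //; lia.
lia.
Qed.

Lemma circle_int_point p : circle p -> exists x, p = int_point x.
Proof.
move=> /circle_pointP [t ->]; exists (t / (pi *+ 2) * N%:R).
rewrite /int_point mulfK ?gt_eqF ?NR0 // mulrC divfK //.
by rewrite gt_eqF // tau_gt0.
Qed.

Lemma int_adjP u v : adj int_graph u v <-> u <> v /\ arcs_meet u v.
Proof.
split=> -[n h]; split=> //.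
  case: h => p [pu pv]; have [x xE] : exists x, p = int_point x.
    by apply: circle_int_point; case: pu => t _ <-; apply/circle_pointP; exists t.
  move: pu pv; rewrite xE => /int_arcP [z /andP[h1 h2]] /int_arcP [z' /andP[h3 h4]].
  have a1 := le_trans h1 h4; have a2 := le_trans h3 h2; rewrite !ler_int in a1 a2.
  pose s := Num.max ((start u)%:Z + N%:Z * z) ((start v)%:Z + N%:Z * z').
  have [t tN tE] := mod_nat s; apply/hasP; exists t => //.
  rewrite -tE !in_arc_mod; apply/andP; split; apply/in_arcP.
    by exists z; rewrite /s; lia.
  by exists z'; rewrite /s; lia.
have /hasP [t _ /andP[h1 h2]] := h; exists (int_point (t%:Z)%:~R).
by split; apply/int_arc_int.
Qed.

Lemma int_proper : all (leq 1) L -> size L = size P ->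
  all (fun i => all (fun j => (i == j) ||
    has (fun t : nat => in_arc i t && ~~ in_arc j t) (iota 0 N)) (iota 0 (size P)))
    (iota 0 (size P)) ->
  proper_arc_representation int_graph int_arc.
Proof.
move=> L0 sizeL chk; split; first split => //.
  move=> v; do 2 eexists; split; last by [].
  rewrite ltr_pM2l ?tau_gt0 // ltr_pM2r ?invr_gt0 ?NR0 // ltr_nat.
  have : len v \in L by rewrite mem_nth // sizeL.
  by move/(allP L0); lia.
move=> u v n sub; have mu : (u : nat) \in iota 0 (size P) by rewrite mem_iota /=.
have mv : (v : nat) \in iota 0 (size P) by rewrite mem_iota /=.
have /allP /(_ _ mv) /orP[/eqP/val_inj //|/hasP [t _ /andP[h1 /negP]]] :=
  allP chk _ mu.
apply; apply/int_arc_int/sub/int_arc_int; exact: h1.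
Qed.

(** The arcs of [S] cover the circle, and no arc contains two points of [T], so a total set needs at
    least [size T] arcs. In the covering test the strict [<] makes the arc contain the whole part
    from [t] to [t + 1]. *)
Lemma int_rho (S T : seq nat) : size T = size S -> uniq T -> (0 < size P)%N ->
  all (fun i => (i < size P)%N) S ->
  all (fun t : nat => has (fun i => ((t%:Z - (start i)%:Z) %% N%:Z)%Z < (len i)%:Z) S)
    (iota 0 N) ->
  all (fun i => all (fun t : nat => all (fun t' : nat =>
     in_arc i t && in_arc i t' ==> (t == t')) T) T) (iota 0 (size P)) ->
  rho int_arc = size S.
Proof.
move=> TS uT P0 Slt cov sep.
have low m : total_size int_arc m -> (size S <= m)%N.
  move=> /total_family [f [_ tot]].
  have /choice [h hP] : forall i : 'I_(size T), exists j : 'I_m, in_arc (f j) (nth 0%N T i).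
    move=> i; have : @circle R (int_point ((nth 0%N T i)%:Z)%:~R).
      by apply/circle_pointP; eexists.
    by rewrite -tot => -[j _ /int_arc_int hj]; exists j.
  have h_inj : injective h.
    move=> i j e; apply: val_inj; apply/eqP; rewrite -(nth_uniq 0%N (ltn_ord i) (ltn_ord j) uT).
    have mf : (f (h i) : nat) \in iota 0 (size P) by rewrite mem_iota /=.
    have /allP /(_ _ (mem_nth 0%N (ltn_ord i))) := allP sep _ mf.
    move=> /allP /(_ _ (mem_nth 0%N (ltn_ord j))) /implyP; apply.
    by rewrite hP e hP.
  by have := leq_card h h_inj; rewrite !card_ord TS.
pose f (i : 'I_(size S)) : V := insubd (Ordinal P0) (nth 0%N S i).
have [m mtot mS] : exists2 m, total_size int_arc m & (m <= size S)%N.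
  apply: (@family_total _ _ _ _ f); apply/seteqP; split=> p.
    by case=> i _ [t _ <-]; apply/circle_pointP; exists t.
  move=> /circle_int_point [x ->].
  pose s := Num.floor x; have /andP[s1 s2] := floor_itv x; rewrite -/s in s1 s2.
  have [t tN tE] := mod_nat s.
  have /hasP [i iS hi] := allP cov _ tN.
  have iP : (i < size P)%N := allP Slt _ iS.
  have kS : (index i S < size S)%N by rewrite index_mem.
  exists (Ordinal kS) => //; apply/int_arcP.
  have -> : f (Ordinal kS) = i :> nat by rewrite /f val_insubd /= nth_index // iP.
  move: hi; rewrite -tE modzDml => hi.
  exists ((s - (start i)%:Z) %/ N%:Z)%Z; apply/andP; split.
    apply: le_trans s1; rewrite ler_int.
    have n0 : N%:Z != 0 by lia.
    by have := divz_eq (s - (start i)%:Z) N%:Z; have := modz_ge0 (s - (start i)%:Z) n0; lia.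
  apply: le_trans (ltW s2) _; rewrite ler_int.
  by have := divz_eq (s - (start i)%:Z) N%:Z; lia.
apply: rho_eq => //.
by have -> : size S = m by apply/eqP; rewrite eqn_leq mS low.
Qed.

Section Cycle.
Variable n : nat.
Hypothesis n0 : (0 < n)%N.
Hypothesis nP : (n <= size P)%N.

Definition int_cycle (i : nat) : V := Ordinal (leq_trans (ltn_pmod i n0) nP).

Lemma int_cycle_per i : int_cycle (i + n) = int_cycle i.
Proof. by apply: val_inj; rewrite /= modnDr. Qed.

Lemma int_cycle_adj :
  all (fun r => (r != r.+1 %% n)%N && arcs_meet r (r.+1 %% n)%N) (iota 0 n) ->
  forall i, adj int_graph (int_cycle i) (int_cycle i.+1).
Proof.
move=> chk i; have mi : (i %% n)%N \in iota 0 n by rewrite mem_iota /= ltn_pmod.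
have /andP[h1 h2] := allP chk _ mi.
have e : (i.+1 %% n = (i %% n).+1 %% n)%N by rewrite -addn1 -modnDml addn1.
apply/int_adjP; rewrite /= e; split=> // /(congr1 val) /= /eqP.
by rewrite e; apply/negP.
Qed.

Lemma int_cycle_inj i j : (i < j < n)%N -> int_cycle i <> int_cycle j.
Proof.
move=> /andP[ij jn] /(congr1 val) /=.
by rewrite !modn_small ?(ltn_trans ij jn) // => e; rewrite e ltnn in ij.
Qed.

Lemma int_cycle_nadj i j : (i < n)%N -> (j < n)%N -> ~~ arcs_meet i j ->
  ~ adj int_graph (int_cycle i) (int_cycle j).
Proof.
move=> i_n j_n /negP h /int_adjP [_]; rewrite /= !modn_small //.
Qed.

End Cycle.

End IntegerArcs.

Theorem theorem3p2 (R : realType) :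
  (forall (V : Type) (G : graph V) (I : V -> set (R * R)),
     proper_arc_representation G I ->
     [/\ (3 <= rho I)%N ->
           (((rho I)%:R / 4)%:E <= delta R G)%E /\
           (delta R G <= ((rho I %/ 2)%:R / 2 + 1)%:E)%E,
         rho I = 1%N -> delta R G = 0%:E &
         rho I = 2%N -> (0%:E <= delta R G)%E /\ (delta R G <= (5 / 4)%:E)%E]) /\
  [/\ exists (V : Type) (G : graph V) (I : V -> set (R * R)),
        [/\ proper_arc_representation G I, (3 <= rho I)%N &
            delta R G = ((rho I)%:R / 4)%:E],
      exists (V : Type) (G : graph V) (I : V -> set (R * R)),
        [/\ proper_arc_representation G I, (3 <= rho I)%N &
            delta R G = ((rho I %/ 2)%:R / 2 + 1)%:E],
      exists (V : Type) (G : graph V) (I : V -> set (R * R)),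
        [/\ proper_arc_representation G I, rho I = 2%N &
            delta R G = 0%:E] &
      exists (V : Type) (G : graph V) (I : V -> set (R * R)),
        [/\ proper_arc_representation G I, rho I = 2%N &
            delta R G = (5 / 4)%:E]].
Proof.
split.
  move=> V G I proper; split; first exact: delta_rho3.
    exact: delta_rho1.
  exact: delta_rho2.
split.
(* Three thirds of the circle, touching at their ends, form a triangle; its diameter 3/2 gives
   [delta] at most 3/4. *)
- pose P := [:: 0; 2; 4]%N; pose L := [:: 2; 2; 2]%N.
  have pr : proper_arc_representation (int_graph R 6 P L) (@int_arc R 6 P L).
    exact: (@int_proper R 6 P L isT).
  have rE : rho (@int_arc R 6 P L) = 3%N.
    by rewrite (@int_rho R 6 P L isT [:: 0; 1; 2]%N [:: 1; 3; 5]%N).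
  exists 'I_3, (int_graph R 6 P L), (@int_arc R 6 P L); rewrite rE; split=> //.
  have := delta_rho3 pr; rewrite rE => /(_ isT) [low _].
  apply/eqP; rewrite eq_le low andbT.
  have -> : 3%:R / 4 = 3 / 2 / 2 :> R by lra.
  apply: delta_le_diam; apply: (@triangle_diam _ _ _ (@Ordinal 3 0 isT) (@Ordinal 3 1 isT)).
  + by [].
  + move=> u v n; apply/(@int_adjP R 6 P L isT); split=> //.
    have chk : all (fun i => all (arcs_meet 6 P L i) (iota 0 3)) (iota 0 3) by [].
    have mu : (u : nat) \in iota 0 3 by rewrite mem_iota /=.
    have mv : (v : nat) \in iota 0 3 by rewrite mem_iota /=.
    exact: (allP (allP chk _ mu) _ mv).
  + move=> a b c d ab cd; have := ltn_ord a; have := ltn_ord b.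
    have := ltn_ord c; have := ltn_ord d => *.
    have vi (x y : 'I_3) : x <> y -> (x : nat) <> y by move=> n /val_inj.
    have := vi _ _ ab; have := vi _ _ cd => *.
    have [e|ac] := pselect (a = c); first by constructor 1.
    have [e|ad] := pselect (a = d); first by constructor 2.
    have [e|bc] := pselect (b = c); first by constructor 3.
    have [e|bd] := pselect (b = d); first by constructor 4.
    have := vi _ _ ac; have := vi _ _ ad; have := vi _ _ bc; have := vi _ _ bd.
    by rewrite /= in ab cd *; lia.
(* Six short arcs form an induced hexagon; three long arcs, none of which
   contains a short one, cover the circle. *)
- pose P := [:: 0; 4; 8; 12; 16; 20; 5; 13; 21]%N.
  pose L := [:: 6; 6; 6; 6; 6; 6; 8; 8; 8]%N.
  have pr : proper_arc_representation (int_graph R 24 P L) (@int_arc R 24 P L).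
    exact: (@int_proper R 24 P L isT).
  have rE : rho (@int_arc R 24 P L) = 3%N.
    by rewrite (@int_rho R 24 P L isT [:: 6; 7; 8]%N [:: 0; 8; 16]%N).
  exists 'I_9, (int_graph R 24 P L), (@int_arc R 24 P L); rewrite rE; split=> //.
  have := delta_rho3 pr; rewrite rE => /(_ isT) [_ up].
  apply/eqP; rewrite eq_le up /=.
  have -> : (3 %/ 2)%:R / 2 + 1 = 3 / 2 :> R by rewrite (_ : 3 %/ 2 = 1)%N //; lra.
  apply: (@delta_ge_hexagon _ _ _ (@int_cycle P 6 isT isT)).
  + exact: (@int_cycle_adj R 24 P L isT 6 isT isT isT).
  + by move=> i; rewrite int_cycle_per.
  + by move=> i j ij; exact: (@int_cycle_inj P 6 isT isT i j ij).
  + move=> i j ij ji; apply: (@int_cycle_nadj R 24 P L isT); [lia|lia|].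
    have chk : all (fun i => all (fun j => (i.+1 < j)%N && (j < i + 5)%N ==>
      ~~ arcs_meet 24 P L i j) (iota 0 6)) (iota 0 6) by [].
    have mi : i \in iota 0 6 by rewrite mem_iota /=; lia.
    have mj : j \in iota 0 6 by rewrite mem_iota /=; lia.
    by apply: (implyP (allP (allP chk _ mi) _ mj)); lia.
(* Two half circles form a single edge. *)
- pose P := [:: 0; 2]%N; pose L := [:: 2; 2]%N.
  have pr : proper_arc_representation (int_graph R 4 P L) (@int_arc R 4 P L).
    exact: (@int_proper R 4 P L isT).
  have rE : rho (@int_arc R 4 P L) = 2%N.
    by rewrite (@int_rho R 4 P L isT [:: 0; 1]%N [:: 1; 3]%N).
  exists 'I_2, (int_graph R 4 P L), (@int_arc R 4 P L); split=> //.
  apply/eqP; rewrite eq_le (delta_rho2 pr rE).1 andbT.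
  apply: (@delta_segment _ _ _ (@Ordinal 2 0 isT) (@Ordinal 2 1 isT)).
    by apply/(@int_adjP R 4 P L isT).
  by case=> -[|[|//]] h; [left | right]; apply: val_inj.
(* A pentagon 0, 1, 2, 3, 4 in which 1 and 4 are adjacent to all vertices. *)
- pose P := [:: 0; 1; 4; 5; 6]%N; pose L := [:: 2; 5; 3; 3; 5]%N.
  have pr : proper_arc_representation (int_graph R 10 P L) (@int_arc R 10 P L).
    exact: (@int_proper R 10 P L isT).
  have rE : rho (@int_arc R 10 P L) = 2%N.
    by rewrite (@int_rho R 10 P L isT [:: 1; 4]%N [:: 3; 8]%N).
  exists 'I_5, (int_graph R 10 P L), (@int_arc R 10 P L); split=> //.
  apply/eqP; rewrite eq_le (delta_rho2 pr rE).2 /=.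
  apply: (@delta_ge_pentagon _ _ _ (@int_cycle P 5 isT isT)).
  + exact: (@int_cycle_adj R 10 P L isT 5 isT isT isT).
  + by move=> i; rewrite int_cycle_per.
  + by move=> i j ij; exact: (@int_cycle_inj P 5 isT isT i j ij).
  + exact: (@int_cycle_nadj R 10 P L isT).
  + exact: (@int_cycle_nadj R 10 P L isT).
Qed.
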